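(* Let $\mathcal E$ be a topos and $(A',A)$ an OPCA pair in $\mathcal E$. Then a relative realizability topos $\mathsf{RT}(A',A)$ exists; that is, there is a pseudoinitial exact model for $(A',A)$: an exact model $(N,D)$ such that for every exact model $(F,C)$ there is, up to isomorphism, a unique morphism $(N,D)\to(F,C)$.
   Context: Topos means elementary topos. Formulas about elements are read in the internal language. An object is inhabited if its map to the terminal object is a regular epimorphism; two subobjects of an object intersect if their intersection is inhabited. A functor between regular categories is regular if it preserves finite limits and regular epimorphisms. OPAS: an object $A$ with a partial order $\leq$ and a monotone partial binary operator $(x,y)\mapsto xy$ (application) whose domain is a downward closed subobject of $A\times A$. Write $xy\downarrow z$ for ''$xy$ is defined and equals $z$'', and $xy\downarrow$ for ''$xy$ is defined''. A partial arrow $f:U\subseteq A^n\to A$ is representable if the subobject $[\![f]\!]=\{a\in A\mid \forall \vec x\in U.\,\exists y\in A.\ y\leq f(\vec x)\wedge ((ax_1)\dots)x_n\downarrow y\}$ is inhabited. The partial combinatory arrows are the least collection of partial arrows $A^n\rightharpoonup A$ (any $n$) containing the projections and closed under pointwise application. An OPCA is an OPAS in which every partial combinatory arrow is representable. OPCA pair $(A',A)$: a pair of OPASes such that $A'$ is a subobject of $A$, application in $A'$ is the restriction of application in $A$; if $x,y\in A'$ and $xy\downarrow z$ in $A$ then $z\in A'$; and for every partial combinatory arrow $f$ of $A$, $[\![f]\!]$ intersects $A'$. For a regular functor $F:\mathcal E\to\mathcal C$, an $F$-filter is a subobject $C\leq FA$ such that (internally in $\mathcal C$): if $x\in C$ and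 $x\leq y$ then $y\in C$; if $x,y\in C$ and $xy\downarrow z$ for some $z\in FA$ then $z\in C$; and (externally) for every subobject $U\subseteq A$ that intersects $A'$, $FU$ intersects $C$. An exact model for $(A',A)$ is a pair $(F,C)$ of a regular functor $F:\mathcal E\to\mathcal C$ to an exact category $\mathcal C$ and an $F$-filter $C$. A morphism $(F:\mathcal E\to\mathcal C,\,C)\to(G:\mathcal E\to\mathcal D,\,D)$ is a regular functor $H:\mathcal C\to\mathcal D$ together with a natural isomorphism $\eta:HF\to G$ such that $\eta_A:HFA\to GA$ restricts to an isomorphism between $HC$ and $D$. A relative realizability topos $\mathsf{RT}(A',A)$ is by definition a pseudoinitial exact model. *)

(* Defs.v *)
(* Plain MathComp (ordinals and sequences only); all category theory is
   developed here.

   Conventions.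
   - Hom-sets are types, and equality of arrows is Leibniz equality.
   - Limits are not chosen: categories are required to have them, and functors
     to preserve their universal properties.
   - A subobject is presented by a monomorphism; a subobject of a power A^n by a
     jointly monic family of n arrows to A.
   - Formulas of the internal language are read by Kripke-Joyal semantics:
     variables are generalized elements x : T -> X, a universal quantifier
     ranges over generalized elements at all later stages p : T' -> T, and an
     existential quantifier is witnessed after a cover, i.e. after pulling back
     along a regular epimorphism.  No cover is needed where the witness is
     unique, and a sequent of formulas that are themselves interpreted as
     subobjects holds iff it holds for all generalized elements. *)

From mathcomp Require Import all_boot.

Set Implicit Arguments.
Unset Strict Implicit.
Unset Printing Implicit Defensive.

Declare Scope cat_scope.
Delimit Scope cat_scope with cat.
Local Open Scope cat_scope.

Record category := Category {
  ob :> Type;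
  hom : ob -> ob -> Type;
  idm : forall X, hom X X;
  comp : forall X Y Z, hom Y Z -> hom X Y -> hom X Z;
  comp1m : forall X Y (f : hom X Y), comp (idm Y) f = f;
  compm1 : forall X Y (f : hom X Y), comp f (idm X) = f;
  compA : forall X Y Z W (h : hom Z W) (g : hom Y Z) (f : hom X Y),
    comp h (comp g f) = comp (comp h g) f
}.

Arguments hom {_} _ _.
Arguments idm {_} _.
Arguments comp {_ _ _ _} _ _.

Notation "g ∘ f" := (comp g f) (at level 40, left associativity) : cat_scope.

Section InACategory.
Variable C : category.
Implicit Types X Y Z T R P : C.

Definition iso X Y (f : hom X Y) : Prop :=
  exists g : hom Y X, g ∘ f = idm X /\ f ∘ g = idm Y.

Definition mono X Y (m : hom X Y) : Prop :=
  forall T (u v : hom T X), m ∘ u = m ∘ v -> u = v.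

Definition jointly_monic2 R X Y (l : hom R X) (r : hom R Y) : Prop :=
  forall T (u v : hom T R), l ∘ u = l ∘ v -> r ∘ u = r ∘ v -> u = v.

Definition jointly_monic n R X (l : 'I_n -> hom R X) : Prop :=
  forall T (u v : hom T R), (forall i, l i ∘ u = l i ∘ v) -> u = v.

Definition is_terminal T : Prop := forall X, exists t : hom X T, forall t' : hom X T, t' = t.

Definition is_pullback X Y Z P (f : hom X Z) (g : hom Y Z)
    (p : hom P X) (q : hom P Y) : Prop :=
  f ∘ p = g ∘ q /\
  forall T (x : hom T X) (y : hom T Y), f ∘ x = g ∘ y ->
    exists! u : hom T P, p ∘ u = x /\ q ∘ u = y.

Definition is_power n P X (pr : 'I_n -> hom P X) : Prop :=
  forall T (x : 'I_n -> hom T X), exists! u : hom T P, forall i, pr i ∘ u = x i.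

Definition is_coequalizer R X Q (f g : hom R X) (e : hom X Q) : Prop :=
  e ∘ f = e ∘ g /\
  forall Y (h : hom X Y), h ∘ f = h ∘ g -> exists! k : hom Q Y, k ∘ e = h.

Definition regular_epi X Q (e : hom X Q) : Prop :=
  exists R (f g : hom R X), is_coequalizer f g e.

Definition inhabited_ob X : Prop :=
  exists T (t : hom X T), is_terminal T /\ regular_epi t.

Definition intersect S S' X (m : hom S X) (m' : hom S' X) : Prop :=
  exists P (p : hom P S) (q : hom P S'), is_pullback m m' p q /\ inhabited_ob P.

(* The generalized element x belongs to the subobject m. *)
Definition mem S X (m : hom S X) T (x : hom T X) : Prop :=
  exists u : hom T S, m ∘ u = x.

Definition rel2 R X Y (l : hom R X) (r : hom R Y)
    T (x : hom T X) (y : hom T Y) : Prop :=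
  exists u : hom T R, l ∘ u = x /\ r ∘ u = y.

(* For a partial arrow v : R -> Z with domain (l, r) : R >-> X x Y, this says
   that v is defined at (x, y) with value z. *)
Definition rel3 R X Y Z (l : hom R X) (r : hom R Y) (v : hom R Z)
    T (x : hom T X) (y : hom T Y) (z : hom T Z) : Prop :=
  exists u : hom T R, [/\ l ∘ u = x, r ∘ u = y & v ∘ u = z].

Definition is_equivalence R X (l r : hom R X) : Prop :=
  [/\ jointly_monic2 l r,
      forall T (x : hom T X), rel2 l r x x,
      forall T (x y : hom T X), rel2 l r x y -> rel2 l r y x
    & forall T (x y z : hom T X), rel2 l r x y -> rel2 l r y z -> rel2 l r x z].

End InACategory.

(* A terminal object and pullbacks generate all finite limits. *)
Definition has_finite_limits (C : category) : Prop :=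
  (exists T : C, is_terminal T) /\
  forall (X Y Z : C) (f : hom X Z) (g : hom Y Z),
    exists P (p : hom P X) (q : hom P Y), is_pullback f g p q.

Definition regular (C : category) : Prop :=
  [/\ has_finite_limits C,
      forall (X Y R : C) (f : hom X Y) (p q : hom R X), is_pullback f f p q ->
        exists Q (e : hom X Q), is_coequalizer p q e
    & forall (X Y Z P : C) (f : hom X Z) (g : hom Y Z)
        (p : hom P X) (q : hom P Y),
        is_pullback f g p q -> regular_epi f -> regular_epi q].

Definition exact (C : category) : Prop :=
  regular C /\
  forall (R X : C) (l r : hom R X), is_equivalence l r ->
    exists Y (f : hom X Y), is_pullback f f l r.

(* (a, e) : E >-> X x PX is the membership relation of a power object of X:
   every relation (l, r) : R >-> X x Y is its pullback along X x k for a unique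
   k : Y -> PX. *)
Definition is_power_object (C : category) (X PX E : C)
    (a : hom E X) (e : hom E PX) : Prop :=
  jointly_monic2 a e /\
  forall (Y R : C) (l : hom R X) (r : hom R Y), jointly_monic2 l r ->
    exists! k : hom Y PX, forall (T : C) (x : hom T X) (y : hom T Y),
      rel2 l r x y <-> rel2 a e x (k ∘ y).

(* An elementary topos: finite limits and power objects. *)
Definition topos (C : category) : Prop :=
  has_finite_limits C /\
  forall X : C, exists (PX E : C) (a : hom E X) (e : hom E PX),
    is_power_object a e.

Record functor (C D : category) := Functor {
  fob :> C -> D;
  fmap : forall X Y : C, hom X Y -> hom (fob X) (fob Y);
  fmap1 : forall X, fmap (idm X) = idm (fob X);
  fmapM : forall X Y Z (g : hom Y Z) (f : hom X Y),
    fmap (g ∘ f) = fmap g ∘ fmap f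
}.

Arguments fmap {_ _} _ {_ _} _.

Definition fcomp (C D E : category) (G : functor D E) (F : functor C D) :
    functor C E.
Proof.
refine (@Functor C E (fun X => G (F X)) (fun _ _ f => fmap G (fmap F f)) _ _).
- by move=> X; rewrite !fmap1.
- by move=> X Y Z g f; rewrite !fmapM.
Defined.

Record nat_iso (C D : category) (F G : functor C D) := NatIso {
  cpt :> forall X, hom (F X) (G X);
  cpt_natural : forall X Y (f : hom X Y), cpt Y ∘ fmap F f = fmap G f ∘ cpt X;
  cpt_iso : forall X, iso (cpt X)
}.

Definition preserves_finite_limits (C D : category) (F : functor C D) : Prop :=
  (forall T : C, is_terminal T -> is_terminal (F T)) /\
  forall (X Y Z P : C) (f : hom X Z) (g : hom Y Z) (p : hom P X) (q : hom P Y),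
    is_pullback f g p q ->
    is_pullback (fmap F f) (fmap F g) (fmap F p) (fmap F q).

Definition regular_functor (C D : category) (F : functor C D) : Prop :=
  preserves_finite_limits F /\
  forall (X Y : C) (e : hom X Y), regular_epi e -> regular_epi (fmap F e).

Record opas (C : category) := Opas {
  car :> C;
  le_ob : C;
  le_l : hom le_ob car;
  le_r : hom le_ob car;
  app_dom : C;
  app_l : hom app_dom car;
  app_r : hom app_dom car;
  app_val : hom app_dom car;
  le_mono : jointly_monic2 le_l le_r;
  le_refl : forall T (x : hom T car), rel2 le_l le_r x x;
  le_trans : forall T (x y z : hom T car),
    rel2 le_l le_r x y -> rel2 le_l le_r y z -> rel2 le_l le_r x z;
  le_antisym : forall T (x y : hom T car),
    rel2 le_l le_r x y -> rel2 le_l le_r y x -> x = y;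
  app_mono : jointly_monic2 app_l app_r;
  app_downward : forall T (x x' y y' : hom T car),
    rel2 le_l le_r x x' -> rel2 le_l le_r y y' ->
    rel2 app_l app_r x' y' -> rel2 app_l app_r x y;
  app_monotone : forall T (x x' y y' z z' : hom T car),
    rel2 le_l le_r x x' -> rel2 le_l le_r y y' ->
    rel3 app_l app_r app_val x y z -> rel3 app_l app_r app_val x' y' z' ->
    rel2 le_l le_r z z'
}.

Arguments le_l {_} _.
Arguments le_r {_} _.
Arguments app_l {_} _.
Arguments app_r {_} _.
Arguments app_val {_} _.

Section Opas.
Variables (C : category) (A : opas C).

Definition le (T : C) (x y : hom T A) : Prop := rel2 (le_l A) (le_r A) x y.

Definition app (T : C) (x y z : hom T A) : Prop :=
  rel3 (app_l A) (app_r A) (app_val A) x y z.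

(* ((a x_1) ...) x_n is defined and equals y. *)
Fixpoint app_seq (T : C) (a : hom T A) (s : seq (hom T A)) (y : hom T A) : Prop :=
  if s is x :: s' then exists b, app a x b /\ app_seq b s' y else a = y.

Record parrow (n : nat) := PArrow {
  pdom : C;
  pleg : 'I_n -> hom pdom A;
  pval : hom pdom A;
  pleg_mono : jointly_monic pleg
}.

(* The partial arrow f is defined at (x_1, ..., x_n) with value y. *)
Definition papply n (f : parrow n) (T : C) (x : 'I_n -> hom T A) (y : hom T A) :
    Prop :=
  exists u : hom T (pdom f), (forall i, pleg f i ∘ u = x i) /\ pval f ∘ u = y.

Definition is_pointwise_app n (f g h : parrow n) : Prop :=
  forall (T : C) (x : 'I_n -> hom T A) (z : hom T A),
    papply h x z <-> exists y y', [/\ papply f x y, papply g x y' & app y y' z].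

Inductive partial_combinatory n : parrow n -> Prop :=
| pc_proj (f : parrow n) (i : 'I_n) :
    is_power (pleg f) -> pval f = pleg f i -> partial_combinatory f
| pc_app (f g h : parrow n) :
    partial_combinatory f -> partial_combinatory g ->
    is_pointwise_app f g h -> partial_combinatory h.

(* Forcing, at stage T, of the formula
     forall x in dom f, exists y in A, y <= f x /\ ((a x_1) ...) x_n is defined
     and equals y. *)
Definition realizes n (f : parrow n) (T : C) (a : hom T A) : Prop :=
  forall (T' : C) (p : hom T' T) (u : hom T' (pdom f)),
  exists (T'' : C) (q : hom T'' T'), regular_epi q /\
  exists y : hom T'' A, le y (pval f ∘ u ∘ q) /\
    app_seq (a ∘ p ∘ q) [seq pleg f i ∘ u ∘ q | i <- enum 'I_n] y.

(* The monomorphism m presents the subobject of realizers of f. *)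
Definition is_realizers n (f : parrow n) (S : C) (m : hom S A) : Prop :=
  mono m /\ forall (T : C) (a : hom T A), mem m a <-> realizes f a.

End Opas.

(* The order of the smaller OPAS need not be the induced one: it plays no role
   below, and the induced order is included as a special case. *)
Record opca_pair (C : category) := OpcaPair {
  big : opas C;
  small : opas C;
  incl : hom small big;
  incl_mono : mono incl;
  incl_app : forall T (x y z : hom T small),
    app x y z <-> app (incl ∘ x) (incl ∘ y) (incl ∘ z);
  incl_closed : forall T (x y : hom T small) (z : hom T big),
    app (incl ∘ x) (incl ∘ y) z -> mem incl z;
  incl_realizers : forall n (f : parrow big n), partial_combinatory f ->
    exists S (m : hom S big), is_realizers f m /\ intersect m incl
}.

Arguments incl {_} _.

Section Models.
Variables (E : category) (AA : opca_pair E).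
Local Notation A := (big AA).

(* Since F preserves jointly monic pairs, the images under F of the order and
   of the application of A are a relation and a partial operation on F A. *)
Definition is_filter (D : category) (F : functor E D)
    (S : D) (c : hom S (F A)) : Prop :=
  [/\ mono c,
      forall T (x y : hom T (F A)),
        mem c x -> rel2 (fmap F (le_l A)) (fmap F (le_r A)) x y -> mem c y,
      forall T (x y z : hom T (F A)), mem c x -> mem c y ->
        rel3 (fmap F (app_l A)) (fmap F (app_r A)) (fmap F (app_val A)) x y z ->
        mem c z
    & forall U (m : hom U A), mono m -> intersect m (incl AA) ->
        intersect (fmap F m) c].

Record exact_model := ExactModel {
  mcat : category;
  mcat_exact : exact mcat;
  mfun : functor E mcat;
  mfun_regular : regular_functor mfun;
  mfil : mcat;
  mfil_incl : hom mfil (mfun A);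
  mfil_filter : is_filter mfil_incl
}.

Record model_morphism (M N : exact_model) := ModelMorphism {
  mor : functor (mcat M) (mcat N);
  mor_regular : regular_functor mor;
  mor_iso : nat_iso (fcomp mor (mfun M)) (mfun N);
  mor_filter : exists k : hom (mor (mfil M)) (mfil N),
    iso k /\ mfil_incl N ∘ k = mor_iso A ∘ fmap mor (mfil_incl M)
}.

Definition isomorphic_morphisms (M N : exact_model) (H K : model_morphism M N) :
    Prop :=
  exists t : nat_iso (mor H) (mor K),
    forall X : E, mor_iso K X ∘ t (mfun M X) = mor_iso H X.

Definition pseudoinitial (M : exact_model) : Prop :=
  forall N : exact_model,
    exists H : model_morphism M N,
    forall K : model_morphism M N, isomorphic_morphisms H K.

End Models.

(* Main.v *)
From mathcomp Require Import all_boot boolp.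
Require Import Defs.

(* RT(A', A) is obtained as the classifying category of the regular theory of
   an exact model, with truth in all exact models in place of derivability.
   An object is a formula on an object X of E that defines a partial
   equivalence relation on F X in every exact model (F, C); an arrow is a
   formula that defines, in every exact model, an arrow between the quotients,
   two such formulas being identified when they agree in all models.
   Evaluation at the models is then a jointly faithful family of functors that
   jointly reflects isomorphisms, pullbacks and regular epimorphisms, so
   exactness holds because in each model the required limits and quotients are
   given by formulas that do not depend on the model.  Evaluation at a model M
   is a morphism to M.  Any other morphism K to M agrees with it, because each
   object c is a quotient of a subobject of a constant object by a relation
   tabulated in the category, so K c and the value of c in M are quotients by
   the same relation. *)

Set Implicit Arguments.
Unset Strict Implicit.
Unset Printing Implicit Defensive.

Local Open Scope cat_scope.

(** * Regular categories *)

Section Categories.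
Variable C : category.

Lemma mono_comp (X Y Z : C) (g : hom Y Z) (f : hom X Y) :
  mono g -> mono f -> mono (g ∘ f).
Proof. by move=> mg mf T u v; rewrite -!compA => /mg /mf. Qed.

Lemma iso_mono (X Y : C) (f : hom X Y) : iso f -> mono f.
Proof.
move=> [g [gf _]] T u v E.
by rewrite -[u]comp1m -[v]comp1m -gf -!compA E.
Qed.

Lemma iso_id (X : C) : iso (idm X).
Proof. by exists (idm X); rewrite comp1m. Qed.

Lemma mono_section_iso (X Y : C) (m : hom X Y) (s : hom Y X) :
  mono m -> m ∘ s = idm Y -> iso m.
Proof.
by move=> mm ms; exists s; split=> //; apply: mm; rewrite compA ms comp1m compm1.
Qed.

Lemma regular_epi_epi (X Y Z : C) (e : hom X Y) (u v : hom Y Z) :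
  regular_epi e -> u ∘ e = v ∘ e -> u = v.
Proof.
case=> R [f [g [efg H]]] E.
have [|k [_ kU]] := H Z (u ∘ e); first by rewrite -!compA efg.
by rewrite -(kU u) // -(kU v).
Qed.

Lemma regular_epi_descent (X Y Z : C) (e : hom X Y) (x : hom X Z) :
  regular_epi e ->
  (forall T (u v : hom T X), e ∘ u = e ∘ v -> x ∘ u = x ∘ v) ->
  exists y, y ∘ e = x.
Proof.
case=> R [f [g [efg H]]] Hx.
by have [|k [kx _]] := H Z x; [exact: Hx | exists k].
Qed.

Lemma iso_regular_epi (X Y : C) (f : hom X Y) : iso f -> regular_epi f.
Proof.
move=> [g [gf fg]]; exists X, (idm X), (idm X); split=> // Z h _.
exists (h ∘ g); split; first by rewrite -compA gf compm1.
by move=> k <-; rewrite -compA fg compm1.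
Qed.

Lemma regular_epi_id (X : C) : regular_epi (idm X).
Proof. exact/iso_regular_epi/iso_id. Qed.

Lemma regular_epi_iso_comp (X Y Z : C) (i : hom Y Z) (e : hom X Y) :
  iso i -> regular_epi e -> regular_epi (i ∘ e).
Proof.
move=> [j [ji ij]] [R [f [g [efg H]]]]; exists R, f, g; split.
  by rewrite -!compA efg.
move=> W h /H [k [kh kU]]; exists (k ∘ j); split.
  by rewrite compA -(compA k) ji compm1.
by move=> l; rewrite compA => /kU ->; rewrite -compA ij compm1.
Qed.

Lemma regular_epi_mono_iso (X Y : C) (f : hom X Y) :
  regular_epi f -> mono f -> iso f.
Proof.
move=> rf mf; have [|g gf] := regular_epi_descent (x := idm X) rf.
  by move=> T u v /mf ->.
exists g; split=> //; apply: (regular_epi_epi rf).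
by rewrite -compA gf compm1 comp1m.
Qed.

Lemma kernel_pair_coequalizer (X Y R : C) (f : hom X Y) (p q : hom R X) :
  is_pullback f f p q -> regular_epi f -> is_coequalizer p q f.
Proof.
move=> [fpq pb] rf; split=> // Z h hpq.
have [|k kh] := regular_epi_descent (x := h) rf.
  move=> T u v /pb [w [[<- <-] _]].
  by rewrite !compA hpq.
exists k; split=> // l lf; apply: (regular_epi_epi rf).
by rewrite kh lf.
Qed.

Lemma terminal_uniq (T X : C) (u v : hom X T) : is_terminal T -> u = v.
Proof. by move=> /(_ X) [t H]; rewrite (H u) (H v). Qed.

Lemma terminal_iso (T T' : C) : is_terminal T -> is_terminal T' ->
  exists f : hom T T', iso f.
Proof.
move=> hT hT'; have [f _] := hT' T; have [g _] := hT T'.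
by exists f, g; split; exact: terminal_uniq.
Qed.

Lemma iso_terminal (T X : C) (f : hom X T) :
  iso f -> is_terminal T -> is_terminal X.
Proof.
move=> [g [gf _]] hT Y; have [t tU] := hT Y; exists (g ∘ t) => t'.
by rewrite -[t']comp1m -gf -compA (tU (f ∘ t')).
Qed.

Lemma pullback_ext (X Y Z P T : C) (f : hom X Z) (g : hom Y Z) (p : hom P X)
    (q : hom P Y) (u v : hom T P) :
  is_pullback f g p q -> p ∘ u = p ∘ v -> q ∘ u = q ∘ v -> u = v.
Proof.
move=> [sq H] E1 E2.
have [|w [_ wU]] := H _ (p ∘ u) (q ∘ u); first by rewrite !compA sq.
by rewrite -(wU u) // -(wU v) // E1 E2.
Qed.

Lemma pullback_iso (X Y Z P Q : C) (f : hom X Z) (g : hom Y Z) (p : hom P X)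
    (q : hom P Y) (k : hom Q P) :
  is_pullback f g p q -> iso k -> is_pullback f g (p ∘ k) (q ∘ k).
Proof.
move=> [sq H] [j [jk kj]]; split; first by rewrite !compA sq.
move=> T x y /H [u [[<- <-] uU]]; exists (j ∘ u); split.
  by rewrite -!compA !(compA k) kj !comp1m.
move=> v [E1 E2]; rewrite (uU (k ∘ v)); last by rewrite !compA.
by rewrite compA jk comp1m.
Qed.

Lemma pullback_comparison (X Y Z P Q : C) (f : hom X Z) (g : hom Y Z)
    (p : hom P X) (q : hom P Y) (p' : hom Q X) (q' : hom Q Y) :
  is_pullback f g p q -> is_pullback f g p' q' ->
  exists k : hom Q P, [/\ p ∘ k = p', q ∘ k = q' & iso k].
Proof.
move=> pb pb'; have [k [[E1 E2] _]] := pb.2 _ _ _ pb'.1.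
have [j [[F1 F2] _]] := pb'.2 _ _ _ pb.1.
exists k; split=> //; exists j; split.
  by apply: (pullback_ext pb'); rewrite compm1 compA ?F1 ?F2.
by apply: (pullback_ext pb); rewrite compm1 compA ?E1 ?E2.
Qed.

Lemma mono_pullback (X Y : C) (m : hom X Y) :
  mono m <-> is_pullback m m (idm X) (idm X).
Proof.
split=> [mm | pb T u v E].
  split=> // T x y /mm ->; exists y; split; first by rewrite comp1m.
  by move=> v [<- _]; rewrite comp1m.
by have [w [[<- <-] _]] := pb.2 _ _ _ E.
Qed.

Lemma mem_iso (S S' X : C) (m : hom S X) (m' : hom S' X) (k : hom S S') :
  mono m -> mono m' -> m' ∘ k = m -> mem m m' -> iso k.
Proof.
move=> mm mm' E [j Ej]; exists j; split.
  by apply: mm; rewrite compA Ej E compm1.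
by apply: mm'; rewrite compA E Ej compm1.
Qed.

Section FiniteLimits.
Hypothesis limC : has_finite_limits C.

Lemma binary_product (X Y : C) :
  exists P (p : hom P X) (q : hom P Y),
  exists T (x : hom X T) (y : hom Y T), is_terminal T /\ is_pullback x y p q.
Proof.
have [[T hT] pbC] := limC; have [x _] := hT X; have [y _] := hT Y.
have [P [p [q pb]]] := pbC _ _ _ x y.
by exists P, p, q, T, x, y.
Qed.

End FiniteLimits.

Section Regular.
Hypothesis rC : regular C.

Let limC : has_finite_limits C. Proof. by case: rC. Qed.

Lemma cover_pull (T T' S : C) (q : hom T' T) (f : hom S T) :
  regular_epi q ->
  exists S' (q' : hom S' S) (f' : hom S' T'), regular_epi q' /\ q ∘ f' = f ∘ q'.
Proof.
move=> rq; case: rC => [[_ pbC] _ st].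
have [P [p [p' pb]]] := pbC _ _ _ q f.
by exists P, p', p; split; [exact: st pb rq | case: pb].
Qed.

(** [I] is the quotient of [X] by the kernel pair of [f]. For [m] monic: two elements of [I] with
    the same image lift to [X] after covers, the lifts agree under [f], so they lie in the kernel
    pair and [e] identifies them. *)
Lemma image_factorization (X Y : C) (f : hom X Y) :
  exists I (e : hom X I) (m : hom I Y), [/\ regular_epi e, mono m & m ∘ e = f].
Proof.
case: rC => [[_ pbC] coeq st].
have [R [p [q pb]]] := pbC _ _ _ f f.
have [I [e coe]] := coeq _ _ _ _ _ _ pb.
have re : regular_epi e by exists R, p, q.
have [m [me _]] := coe.2 _ f pb.1.
exists I, e, m; split=> // T u v E.
have [T1 [q1 [x1 [r1 E1]]]] := cover_pull u re.
have [T2 [q2 [x2 [r2 E2]]]] := cover_pull (v ∘ q1) re.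
apply: (regular_epi_epi r1); apply: (regular_epi_epi r2).
rewrite -E1 -E2 -compA.
have [|w [[<- <-] _]] := pb.2 _ (x1 ∘ q2) x2; last by rewrite !compA coe.1.
by rewrite -me -!compA (compA e x1) E1 E2 !compA E.
Qed.

(** Factor the composite as [m ∘ e] with [m] monic. Then [e] descends first along [f], then along
    [g], and the result is a section of [m], so [m] is an isomorphism. *)
Lemma regular_epi_comp (X Y Z : C) (g : hom Y Z) (f : hom X Y) :
  regular_epi g -> regular_epi f -> regular_epi (g ∘ f).
Proof.
move=> rg rf; have [I [e [m [re mm E]]]] := image_factorization (g ∘ f).
rewrite -E; apply: regular_epi_iso_comp => //.
have [|e' E'] := regular_epi_descent (x := e) rf.
  by move=> T u v F; apply: mm; rewrite !compA E -!compA F.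
have Eg : m ∘ e' = g by apply: (regular_epi_epi rf); rewrite -compA E' E.
have [|s Es] := regular_epi_descent (x := e') rg.
  by move=> T u v F; apply: mm; rewrite !compA Eg F.
apply: (mono_section_iso (s := s)) => //; apply: (regular_epi_epi rg).
by rewrite -compA Es Eg comp1m.
Qed.

Lemma regular_epi_cancel (X Y Z : C) (g : hom Y Z) (f : hom X Y) :
  regular_epi (g ∘ f) -> regular_epi g.
Proof.
move=> rgf; have [I [e [m [re mm E]]]] := image_factorization g.
rewrite -E; apply: regular_epi_iso_comp => //.
have [|s Es] := regular_epi_descent (x := e ∘ f) rgf.
  by move=> T u v F; apply: mm; rewrite -E in F; rewrite !compA.
apply: (mono_section_iso (s := s)) => //; apply: (regular_epi_epi rgf).
by rewrite -compA Es compA E comp1m.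
Qed.

(** The generic element [idm Y] suffices: if it lifts along [f] after a cover [q], then [q = f ∘ x],
    and [f] is a regular epimorphism by cancellation. *)
Lemma cover_lift (X Y : C) (f : hom X Y) :
  (forall T (y : hom T Y), exists T' (q : hom T' T),
     regular_epi q /\ exists x : hom T' X, f ∘ x = y ∘ q) ->
  regular_epi f.
Proof.
move=> /(_ Y (idm Y)) [T [q [rq [x E]]]]; rewrite comp1m in E.
by apply: (@regular_epi_cancel _ _ _ _ x); rewrite E.
Qed.

Lemma cover2 (T S1 S2 : C) (q1 : hom S1 T) (q2 : hom S2 T) :
  regular_epi q1 -> regular_epi q2 ->
  exists S (r1 : hom S S1) (r2 : hom S S2),
    regular_epi (q1 ∘ r1) /\ q1 ∘ r1 = q2 ∘ r2.
Proof.
move=> c1 c2; have [S [r1 [r2 [c E]]]] := cover_pull q1 c2.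
exists S, r1, r2; split; last by rewrite E.
exact: regular_epi_comp.
Qed.

(* Arrows into Z form a sheaf for covers: uniqueness makes local witnesses
   of P descend. *)
Lemma glue (T Z : C) (P : forall T', hom T' T -> hom T' Z -> Prop) :
  (forall S S' (p : hom S T) w (r : hom S' S), P S p w -> P S' (p ∘ r) (w ∘ r)) ->
  (forall S (p : hom S T) w w', P S p w -> P S p w' -> w = w') ->
  (forall S S' (p : hom S T) w (q : hom S' S), regular_epi q ->
     P S' (p ∘ q) (w ∘ q) -> P S p w) ->
  (exists T' (q : hom T' T), regular_epi q /\ exists w, P T' q w) ->
  exists w, P T (idm T) w.
Proof.
move=> st un lo [T' [q [rq [w Pw]]]].
have [|w0 E] := regular_epi_descent (x := w) rq.
  move=> S u v F; have := st _ _ _ _ v Pw; rewrite -F => Pv.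
  exact: un (st _ _ _ _ u Pw) Pv.
by exists w0; apply: (lo _ _ _ _ q) => //; rewrite comp1m E.
Qed.

Lemma mem_cover (S X T T' : C) (m : hom S X) (x : hom T X) (q : hom T' T) :
  mono m -> regular_epi q -> mem m (x ∘ q) -> mem m x.
Proof.
move=> mm rq [u Eu]; have [|v Ev] := regular_epi_descent (x := u) rq.
  by move=> W a b E; apply: mm; rewrite !compA Eu -!compA E.
by exists v; apply: (regular_epi_epi rq); rewrite -compA Ev.
Qed.

Lemma relation_image (U X Y : C) (a : hom U X) (b : hom U Y) :
  exists L (l : hom L X) (r : hom L Y) (k : hom U L),
    [/\ jointly_monic2 l r, regular_epi k, l ∘ k = a & r ∘ k = b].
Proof.
have [P [p [q [T [x [y [hT pb]]]]]]] := binary_product limC X Y.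
have [|h [[Ea Eb] _]] := pb.2 _ a b; first exact: terminal_uniq.
have [L [k [m [rk mm E]]]] := image_factorization h.
exists L, (p ∘ m), (q ∘ m), k; split=> //; rewrite -?compA ?E //.
move=> W u v E1 E2; apply: mm; apply: (pullback_ext pb); by rewrite !compA.
Qed.

Lemma inhabited_codomain (X Y : C) (f : hom X Y) :
  inhabited_ob X -> inhabited_ob Y.
Proof.
move=> [T [t [hT rt]]]; have [s _] := hT Y; exists T, s; split=> //.
apply: (@regular_epi_cancel _ _ _ _ f).
by rewrite (terminal_uniq (s ∘ f) t hT).
Qed.

Lemma inhabited_terminal (X T : C) (t : hom X T) :
  inhabited_ob X -> is_terminal T -> regular_epi t.
Proof.
move=> [T' [t' [hT' rt']]] hT; have [f fi] := terminal_iso hT' hT.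
rewrite (terminal_uniq t (f ∘ t') hT).
exact: regular_epi_iso_comp.
Qed.

End Regular.

End Categories.

(* V is the limit of the two spans; its universal property is only needed
   after applying a functor. *)
Lemma span_meet (C : category) (limC : has_finite_limits C) (U U' X Y : C)
    (p : hom U X) (q : hom U Y) (p' : hom U' X) (q' : hom U' Y) :
  exists V (v : hom V U) (v' : hom V U'),
    [/\ p ∘ v = p' ∘ v', q ∘ v = q' ∘ v' &
     forall (D : category) (K : functor C D), preserves_finite_limits K ->
     forall T (u : hom T (K U)) (u' : hom T (K U')),
       fmap K p ∘ u = fmap K p' ∘ u' -> fmap K q ∘ u = fmap K q' ∘ u' ->
       exists w : hom T (K V), fmap K v ∘ w = u /\ fmap K v' ∘ w = u'].
Proof.
have [B [b1 [b2 [O [x [y [hO pb]]]]]]] := binary_product limC X Y.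
have [|h [[Ep Eq] _]] := pb.2 _ p q; first exact: terminal_uniq.
have [|h' [[Ep' Eq'] _]] := pb.2 _ p' q'; first exact: terminal_uniq.
have [V [v [v' pbV]]] := limC.2 _ _ _ h h'.
exists V, v, v'; split.
- by rewrite -Ep -Ep' -!compA pbV.1.
- by rewrite -Eq -Eq' -!compA pbV.1.
move=> D K [_ pK] T u u' E1 E2.
have [|w [Hw _]] := (pK _ _ _ _ _ _ _ _ pbV).2 _ u u'; last by exists w.
apply: (pullback_ext (pK _ _ _ _ _ _ _ _ pb)).
  by rewrite !compA -!fmapM Ep Ep'.
by rewrite !compA -!fmapM Eq Eq'.
Qed.

(** * Transport along functors and natural isomorphisms *)

Lemma fmap_iso (C D : category) (F : functor C D) (X Y : C) (f : hom X Y) :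
  iso f -> iso (fmap F f).
Proof. by move=> [g [gf fg]]; exists (fmap F g); rewrite -!fmapM gf fg !fmap1. Qed.

Lemma fmap_mono (C D : category) (F : functor C D) (X Y : C) (m : hom X Y) :
  preserves_finite_limits F -> mono m -> mono (fmap F m).
Proof.
by move=> [_ pF] /mono_pullback /pF; rewrite !fmap1 => /mono_pullback.
Qed.

Lemma nat_iso_terminal (C D : category) (F G : functor C D) (t : nat_iso F G)
    (X : C) : is_terminal (G X) -> is_terminal (F X).
Proof. exact: iso_terminal (cpt_iso t X). Qed.

Lemma nat_iso_pullback (C D : category) (F G : functor C D) (t : nat_iso F G)
    (X Y Z P : C) (f : hom X Z) (g : hom Y Z) (p : hom P X) (q : hom P Y) :
  is_pullback (fmap G f) (fmap G g) (fmap G p) (fmap G q) ->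
  is_pullback (fmap F f) (fmap F g) (fmap F p) (fmap F q).
Proof.
move=> pb; have tm W := iso_mono (cpt_iso t W).
split.
  by apply: (tm Z); rewrite !compA !cpt_natural -!compA !cpt_natural !compA pb.1.
move=> T x y Exy; have [|u [[Ex Ey] _]] := pb.2 _ (t X ∘ x) (t Y ∘ y).
  by rewrite !compA -!cpt_natural -!compA Exy.
have [s [st ts]] := cpt_iso t P.
have Ex' : fmap F p ∘ (s ∘ u) = x.
  by apply: (tm X); rewrite compA cpt_natural -compA (compA (t P)) ts comp1m.
have Ey' : fmap F q ∘ (s ∘ u) = y.
  by apply: (tm Y); rewrite compA cpt_natural -compA (compA (t P)) ts comp1m.
exists (s ∘ u); split=> // v [E1 E2].
apply: (tm P); apply: (pullback_ext pb).
  by rewrite !(compA _ (t P)) -!cpt_natural -!compA E1 Ex'.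
by rewrite !(compA _ (t P)) -!cpt_natural -!compA E2 Ey'.
Qed.

Lemma nat_iso_regular_epi (C D : category) (F G : functor C D)
    (t : nat_iso F G) (X Y : C) (f : hom X Y) :
  regular D -> regular_epi (fmap G f) -> regular_epi (fmap F f).
Proof.
move=> rD rf; have [s [st ts]] := cpt_iso t Y.
have -> : fmap F f = s ∘ (fmap G f ∘ t X).
  by rewrite -cpt_natural compA st comp1m.
apply: regular_epi_iso_comp; first by exists (t Y).
by apply: regular_epi_comp => //; apply: iso_regular_epi; apply: cpt_iso.
Qed.

(** * Formulas and their quotients in a model *)

Section Syntactic.
Variables (E : category) (AA : opca_pair E).
Hypothesis limE : has_finite_limits E.
Local Notation A := (big AA).
Local Notation model := (exact_model AA).

Lemma model_regular (M : model) : regular (mcat M).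
Proof. by case: (mcat_exact M). Qed.

Lemma mfil_mono (M : model) : mono (mfil_incl M).
Proof. by case: (mfil_filter M). Qed.

Hint Resolve model_regular mfil_mono regular_epi_id : core.

(* Regular formulas in two free variables, written as a calculus of relations;
   Fil is the filter viewed as a coreflexive relation. *)
Inductive form : E -> E -> Type :=
| Graph X Y (f : hom X Y) : form X Y
| Conv X Y (G : form X Y) : form Y X
| Comp X Y Z (G : form X Y) (H : form Y Z) : form X Z
| Meet X Y (G H : form X Y) : form X Y
| Fil : form A A.

(* Forcing in the model M. *)
Fixpoint sat (M : model) X Y (G : form X Y) {struct G} :
    forall T, hom T (mfun M X) -> hom T (mfun M Y) -> Prop :=
  match G in form X Y
    return forall T, hom T (mfun M X) -> hom T (mfun M Y) -> Prop with
  | Graph _ _ f => fun T x y => fmap (mfun M) f ∘ x = y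
  | Conv _ _ G => fun T y x => sat G x y
  | Comp _ Y _ G H => fun T x z => exists T' (q : hom T' T), regular_epi q /\
      exists y : hom T' (mfun M Y), sat G (x ∘ q) y /\ sat H y (z ∘ q)
  | Meet _ _ G H => fun T x y => sat G x y /\ sat H x y
  | Fil => fun T x y => x = y /\ mem (mfil_incl M) x
  end.

Lemma sat_Meet (M : model) X Y (G H : form X Y) T (x : hom T (mfun M X)) y :
  sat (Meet G H) x y <-> sat G x y /\ sat H x y.
Proof. by []. Qed.

Lemma sat_local (M : model) X Y (G : form X Y) T T' (x : hom T (mfun M X)) y
    (q : hom T' T) : regular_epi q -> sat G (x ∘ q) (y ∘ q) -> sat G x y.
Proof.
elim: G T T' x y q => {X Y} /=.
- move=> X Y f T T' x y q rq Eq; apply: (regular_epi_epi rq).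
  by rewrite -compA.
- by move=> X Y G IH T T' x y q /IH; apply.
- move=> X Y Z G IHG H IHH T T' x z q rq [S [r [rr [y [Gy Hy]]]]].
  exists S, (q ∘ r); split; first exact: regular_epi_comp.
  by exists y; rewrite !compA.
- move=> X Y G IHG H IHH T T' x y q rq [Gxy Hxy].
  by split; [exact: IHG Gxy | exact: IHH Hxy].
- move=> T T' x y q rq [Eq mx]; split; first exact: regular_epi_epi Eq.
  exact: mem_cover mx.
Qed.

Lemma sat_Comp (M : model) X Y Z (G : form X Y) (H : form Y Z) T
    (x : hom T (mfun M X)) y z : sat G x y -> sat H y z -> sat (Comp G H) x z.
Proof.
move=> Gxy Hyz; exists T, (idm T); split=> //.
by exists y; rewrite !compm1.
Qed.

Definition Pull X X' Y Y' (f : hom X X') (g : hom Y Y') (G : form X' Y') :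
    form X Y :=
  Comp (Graph f) (Comp G (Conv (Graph g))).

Lemma sat_Pull (M : model) X X' Y Y' (f : hom X X') (g : hom Y Y')
    (G : form X' Y') T (x : hom T (mfun M X)) y :
  sat (Pull f g G) x y <-> sat G (fmap (mfun M) f ∘ x) (fmap (mfun M) g ∘ y).
Proof.
split=> [[T1 [q1 [r1 [_ [<- [T2 [q2 [r2 [y' [Gxy Ey]]]]]]]]]] | Gxy].
  apply: (sat_local (q := q1)) => //; apply: (sat_local (q := q2)) => //.
  by rewrite -Ey -!compA in Gxy; rewrite -!compA.
by apply: (sat_Comp (y := fmap (mfun M) f ∘ x)) => //; apply: sat_Comp Gxy _.
Qed.

(* The tabulating span is chosen before M and K. *)
Lemma tabulation (N : model) X Y (G : form X Y) :
  exists U (p : hom U (mfun N X)) (q : hom U (mfun N Y)),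
  forall (M : model) (K : model_morphism N M) T (x : hom T (mfun M X)) y,
    sat G x y <-> exists T' (r : hom T' T), regular_epi r /\
      exists u : hom T' (mor K U),
        mor_iso K X ∘ fmap (mor K) p ∘ u = x ∘ r /\
        mor_iso K Y ∘ fmap (mor K) q ∘ u = y ∘ r.
Proof.
elim: G => {X Y}.
- move=> X Y f; exists (mfun N X), (idm _), (fmap (mfun N) f) => M K T x y.
  split=> /= [<- | [T' [r [rr [u [E1 E2]]]]]].
    have [j [_ Ej]] := cpt_iso (mor_iso K) X.
    exists T, (idm T); split=> //; exists (j ∘ x).
    rewrite fmap1 !compm1; split; first by rewrite compA Ej comp1m.
    have /= -> := cpt_natural (mor_iso K) f.
    by rewrite -compA (compA (mor_iso K X)) Ej comp1m.
  apply: (regular_epi_epi rr); rewrite -E2 -compA -E1 fmap1 compm1.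
  by have /= -> := cpt_natural (mor_iso K) f; rewrite -compA.
- move=> X Y G [U [p [q H]]]; exists U, q, p => M K T x y.
  split=> [/(H _ K) [T' [r [rr [u [E1 E2]]]]] | [T' [r [rr [u [E1 E2]]]]]].
    by exists T', r; split=> //; exists u.
  by apply/(H _ K); exists T', r; split=> //; exists u.
- move=> X Y Z G [U [p [q HG]]] H [V [s [t HH]]].
  have [[_ pbN] _ _] := model_regular N.
  (* A composite is tabulated by the pullback of the two spans over [Y], which [mor K] preserves. *)
  have [W [a [b pb]]] := pbN _ _ _ q s.
  exists W, (p ∘ a), (t ∘ b) => M K T x z.
  have [[_ pK] _] := mor_regular K; have {}pK := pK _ _ _ _ _ _ _ _ pb.
  split=> [[T1 [q1 [r1 [y []]]]] | [T1 [q1 [r1 [u [E1 E2]]]]]].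
    move=> /(HG _ K) [T2 [q2 [r2 [u [Eu1 Eu2]]]]].
    move=> /(HH _ K) [T3 [q3 [r3 [v [Ev1 Ev2]]]]].
    have [T4 [c [d [rc Ecd]]]] := cover2 (model_regular M) r2 r3.
    have [|w [[Ew1 Ew2] _]] := pK.2 _ (u ∘ c) (v ∘ d).
      apply: (iso_mono (cpt_iso (mor_iso K) Y)).
      by rewrite !compA Eu2 Ev1 -!compA Ecd.
    exists T4, (q1 ∘ (q2 ∘ c)); split; first exact: regular_epi_comp.
    exists w; rewrite !fmapM; split.
      by rewrite -!compA Ew1 !compA Eu1.
    by rewrite -!compA Ew2 Ecd !compA Ev2.
  exists T1, q1; split=> //.
  exists (mor_iso K Y ∘ fmap (mor K) q ∘ (fmap (mor K) a ∘ u)); split.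
    apply/(HG _ K); exists T1, (idm T1); split=> //; exists (fmap (mor K) a ∘ u).
    by rewrite !compm1 -E1 fmapM !compA.
  apply/(HH _ K); exists T1, (idm T1); split=> //; exists (fmap (mor K) b ∘ u).
  rewrite !compm1 -E2 fmapM !compA; split=> //.
  by rewrite -!(compA (mor_iso K Y)) pK.1.
- move=> X Y G [U [p [q HG]]] H [U' [p' [q' HH]]].
  have limN : has_finite_limits (mcat N) by case: (model_regular N).
  have [V [v [v' [E1 E2 HV]]]] := span_meet limN p q p' q'.
  exists V, (p ∘ v), (q ∘ v) => M K T x y.
  split=> [[/(HG _ K) [T2 [q2 [r2 [u [Eu1 Eu2]]]]] /(HH _ K)] | [T1 [q1 [r1 [u [F1 F2]]]]]].
    move=> [T3 [q3 [r3 [u' [Ev1 Ev2]]]]].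
    have [T4 [c [d [rc Ecd]]]] := cover2 (model_regular M) r2 r3.
    have [||w [Ew1 Ew2]] := HV _ (mor K) (mor_regular K).1 _ (u ∘ c) (u' ∘ d).
    + apply: (iso_mono (cpt_iso (mor_iso K) X)).
      by rewrite !compA Eu1 Ev1 -!compA Ecd.
    + apply: (iso_mono (cpt_iso (mor_iso K) Y)).
      by rewrite !compA Eu2 Ev2 -!compA Ecd.
    exists T4, (q2 ∘ c); split=> //; exists w; rewrite !fmapM -!compA Ew1.
    by rewrite !compA Eu1 Eu2.
  split; [apply/(HG _ K) | apply/(HH _ K)]; exists T1, q1; split=> //.
    by exists (fmap (mor K) v ∘ u); rewrite -F1 -F2 !fmapM !compA.
  exists (fmap (mor K) v' ∘ u).
  by rewrite -F1 -F2 E1 E2 !fmapM !compA.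
(* The filter tabulates itself, since [mor_filter] identifies its image under [mor K] with the
   filter of [M]. *)
- exists (mfil N), (mfil_incl N), (mfil_incl N) => M K T x y.
  have [k [[j [jk kj]] Ek]] := mor_filter K.
  split=> /= [[<- [u Eu]] | [T' [r [rr [u [E1 E2]]]]]].
    exists T, (idm T); split=> //; exists (j ∘ u).
    rewrite -Ek !compm1; suff -> : mfil_incl M ∘ k ∘ (j ∘ u) = x by [].
    by rewrite -compA (compA k) kj comp1m.
  split; first by apply: (regular_epi_epi rr); rewrite -E1 -E2.
  by apply: (mem_cover _ rr) => //; exists (k ∘ u); rewrite compA Ek.
Qed.

(** * The identity morphism of a model *)

Definition id_functor (C : category) : functor C C :=
  @Functor C C id (fun _ _ f => f) (fun _ => erefl) (fun _ _ _ _ _ => erefl).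

Lemma id_functor_regular (C : category) : regular_functor (id_functor C).
Proof. by []. Qed.

Definition id_iso (M : model) :
  nat_iso (fcomp (id_functor (mcat M)) (mfun M)) (mfun M).
Proof.
refine (@NatIso _ _ (fcomp (id_functor (mcat M)) (mfun M)) (mfun M)
  (fun X => idm _) _ _) => [X Y f | X] /=; first by rewrite comp1m compm1.
exact: iso_id.
Defined.

Definition id_morphism (M : model) : model_morphism M M.
Proof.
refine (@ModelMorphism _ _ M M (id_functor (mcat M))
  (id_functor_regular _) (id_iso M) _).
by exists (idm _); split; [exact: iso_id | rewrite /= comp1m compm1].
Defined.

(** * Partial equivalence relations and their quotients *)

Definition per (M : model) X (R : form X X) : Prop :=
  (forall T (x y : hom T (mfun M X)), sat R x y -> sat R y x) /\
  (forall T (x y z : hom T (mfun M X)), sat R x y -> sat R y z -> sat R x z).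

(* Q is the quotient of the domain of the partial equivalence relation R;
   nm x z reads: x lies in that domain and z is its class. *)
Definition is_quotient (M : model) X (R : form X X) (Q : mcat M)
    (nm : forall T, hom T (mfun M X) -> hom T Q -> Prop) : Prop :=
  [/\ forall T T' (x : hom T (mfun M X)) z (p : hom T' T),
        nm T x z -> nm T' (x ∘ p) (z ∘ p),
      forall T (z : hom T Q), exists T' (q : hom T' T), regular_epi q /\
        exists x, nm T' x (z ∘ q),
      forall T (x x' : hom T (mfun M X)) z z', nm T x z -> nm T x' z' ->
        (sat R x x' <-> z = z')
    & forall T (x : hom T (mfun M X)), sat R x x -> exists z, nm T x z].

(** Tabulate [R] by a span, using the identity morphism of [M]. The image [S] of the first leg is
    the domain of [R], on which [R] becomes an equivalence relation [L]. Exactness makes [L] the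
    kernel pair of some [f], and [Q] is the image of [f]. *)
Lemma quotient_exists (M : model) X (R : form X X) : per M R ->
  exists (Q : mcat M) nm, is_quotient R (Q := Q) nm.
Proof.
move=> [symR trR]; have [U [p [q HU]]] := tabulation M R.
have {}HU T (x y : hom T (mfun M X)) : sat R x y <->
    exists T' (r : hom T' T), regular_epi r /\
      exists u, p ∘ u = x ∘ r /\ q ∘ u = y ∘ r.
  by have /= H := HU M (id_morphism M) T x y; rewrite !comp1m in H.
have [S [e0 [m [re0 mm E0]]]] := image_factorization (model_regular M) p.
have Rpq T (u : hom T U) : sat R (p ∘ u) (q ∘ u).
  by apply/HU; exists T, (idm T); split=> //; exists u; rewrite !compm1.
have domR T (x : hom T (mfun M X)) : sat R x x <-> mem m x.
  split=> [/HU [T' [r [rr [u [Eu _]]]]] | [s <-]].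
    by apply: (mem_cover mm rr); exists (e0 ∘ u); rewrite compA E0.
  have [T' [r [s' [rr Es]]]] := cover_pull (model_regular M) s re0.
  apply: (sat_local rr); rewrite -compA -Es compA E0.
  exact: trR (Rpq _ s') (symR _ _ _ (Rpq _ s')).
have [b Eb] : mem m q.
  apply/domR; have := Rpq _ (idm U); rewrite !compm1 => Ruu.
  exact: trR (symR _ _ _ Ruu) Ruu.
have [L [l [r [k [jm rk El Er]]]]] := relation_image (model_regular M) e0 b.
have HL T (s s' : hom T S) : rel2 l r s s' <-> sat R (m ∘ s) (m ∘ s').
  split=> [[w [<- <-]] | /HU [T' [c [rc [u [E1 E2]]]]]].
    have [T' [c [w' [rc Ew]]]] := cover_pull (model_regular M) w rk.
    apply: (sat_local rc); rewrite -!compA -Ew !(compA _ k) El Er.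
    by rewrite !compA E0 Eb.
  have Es : e0 ∘ u = s ∘ c by apply: mm; rewrite !compA E0.
  have Es' : b ∘ u = s' ∘ c by apply: mm; rewrite !compA Eb.
  have [|w Ew] := regular_epi_descent (x := k ∘ u) rc.
    move=> V v v' Ev; apply: jm.
      by rewrite !compA El Es -!compA Ev.
    by rewrite !compA Er Es' -!compA Ev.
  exists w; split; apply: (regular_epi_epi rc); rewrite -compA Ew compA.
    by rewrite El.
  by rewrite Er.
have eqv : is_equivalence l r.
  split=> //.
  - by move=> T s; apply/HL/domR; exists s.
  - by move=> T s s' /HL /symR /HL.
  - by move=> T s s' s'' /HL H1 /HL H2; apply/HL; apply: trR H1 H2.
have [_ /(_ _ _ _ _ eqv) [Y [f pb]]] := mcat_exact M.
have [Q [e [i [re mi Ei]]]] := image_factorization (model_regular M) f.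
exists Q, (fun T x z => exists s, m ∘ s = x /\ e ∘ s = z); split.
- move=> T T' x z c [s [<- <-]]; exists (s ∘ c); by rewrite !compA.
- move=> T z; have [T' [c [s [rc Es]]]] := cover_pull (model_regular M) z re.
  by exists T', c; split=> //; exists (m ∘ s), s.
- move=> T x x' z z' [s [<- <-]] [s' [<- <-]]; split=> [/HL [w [<- <-]] | Es].
    by apply: mi; rewrite !compA Ei -!compA !(compA f) pb.1.
  apply/HL; have [|w [[<- <-] _]] := pb.2 _ s s'; first by rewrite -Ei -!compA Es.
  by exists w.
- by move=> T x /domR [s <-]; exists (e ∘ s), s.
Qed.



(** * Elements of a quotient and their names *)

Section Names.
Variables (M : model) (X : E) (R : form X X) (perR : per M R).
Variables (Q : mcat M) (nm : forall T, hom T (mfun M X) -> hom T Q -> Prop).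
Arguments nm {T} _ _.
Hypothesis quo : is_quotient R (@nm).

Lemma name_uniq T (x : hom T (mfun M X)) z z' : nm x z -> nm x z' -> z = z'.
Proof.
case: quo => _ _ H _ n n'; apply/(H _ _ _ _ _ n n').
have Rx : sat R x x by apply/(H _ _ _ _ _ n n).
exact: Rx.
Qed.

Lemma name_sat T (x x' : hom T (mfun M X)) z : nm x z -> nm x' z -> sat R x x'.
Proof. by case: quo => _ _ H _ n n'; apply/(H _ _ _ _ _ n n'). Qed.

Lemma sat_name T (x x' : hom T (mfun M X)) :
  sat R x x' -> exists z, nm x z /\ nm x' z.
Proof.
case: perR quo => symR trR [_ _ H ex] Rx; have Rx' := symR _ _ _ Rx.
have [z n] := ex _ _ (trR _ _ _ _ Rx Rx').
have [z' n'] := ex _ _ (trR _ _ _ _ Rx' Rx).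
by exists z; split=> //; move/(H _ _ _ _ _ n n') : Rx => ->.
Qed.

Lemma name_local T T' (x : hom T (mfun M X)) z (q : hom T' T) :
  regular_epi q -> nm (x ∘ q) (z ∘ q) -> nm x z.
Proof.
case: quo => st _ H ex rq n; have Rx := sat_local rq (name_sat n n).
have [z' n'] := ex _ _ Rx.
by rewrite -(regular_epi_epi rq (name_uniq (st _ _ _ _ q n') n)).
Qed.

(** The generic element of [Q] has a name after a cover, hence a value under [P] there. Invariance
    of [P] under [R] makes the value independent of the name, so it glues to an arrow. *)
Lemma functional_arrow (Z : mcat M)
    (P : forall T, hom T (mfun M X) -> hom T Z -> Prop) :
  (forall T T' (x : hom T (mfun M X)) w (p : hom T' T),
     P T x w -> P T' (x ∘ p) (w ∘ p)) ->
  (forall T (x x' : hom T (mfun M X)) w w',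
     sat R x x' -> P T x w -> P T x' w' -> w = w') ->
  (forall T (x : hom T (mfun M X)), sat R x x -> exists w, P T x w) ->
  exists f : hom Q Z, forall T x (z : hom T Q) w, nm x z -> P T x w -> f ∘ z = w.
Proof.
(* Quantifying over all names at all later stages gives [ok] the stability and locality that [glue]
   requires. *)
case: quo => nm_st co _ _ st un ex; pose ok T (z : hom T Q) w :=
  forall S (p : hom S T) x v, nm x (z ∘ p) -> P S x v -> w ∘ p = v.
have [||||f Hf] := @glue _ Q Z ok.
- by move=> S S' z w r o W p x v; rewrite -!compA; apply: o.
- move=> S z w w' o o'; have [T [q [rq [x n]]]] := co _ z.
  have [v Pv] := ex _ _ (name_sat n n).
  by apply: (regular_epi_epi rq); rewrite (o _ _ _ _ n Pv) (o' _ _ _ _ n Pv).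
- move=> S S' z w q rq o T p x v n Pv.
  have [T' [q' [p' [rq' Ep]]]] := cover_pull (model_regular M) p rq.
  apply: (regular_epi_epi rq'); rewrite -compA -Ep compA.
  apply: o (st _ _ _ _ q' Pv).
  by rewrite -compA Ep compA; apply: nm_st.
- have [T [q [rq [x]]]] := co _ (idm Q); rewrite comp1m => n.
  have [w Pw] := ex _ _ (name_sat n n).
  exists T, q; split=> //; exists w => S p x' v n' Pv.
  by apply: un (st _ _ _ _ p Pw) Pv; apply: name_sat (nm_st _ _ _ _ p n) n'.
by exists f => T x z w n Pw; apply: Hf Pw; rewrite comp1m.
Qed.

End Names.

(** Each naming relation induces an arrow into the other quotient, and the composites are identities
    because they preserve names. This yields both the isomorphisms [eta] and the comparison of
    evaluation with any other morphism. *)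
Lemma quotient_comparison (M : model) X (R : form X X) (Q Q' : mcat M)
    (nm : forall T, hom T (mfun M X) -> hom T Q -> Prop)
    (nm' : forall T, hom T (mfun M X) -> hom T Q' -> Prop) :
  is_quotient R nm -> is_quotient R nm' ->
  exists t : hom Q Q', iso t /\
    forall T x (z : hom T Q), nm T x z -> nm' T x (t ∘ z).
Proof.
have arr (P P' : mcat M) np np' :
    is_quotient R (Q := P) np -> is_quotient R (Q := P') np' ->
    exists t : hom P P', forall T x (z : hom T P), np T x z -> np' T x (t ∘ z).
  move=> quo quo'; case: (quo') => [st' _ H' ex'].
  have [||t Ht] := functional_arrow quo st'.
  - by move=> T x x' w w' Rx n n'; apply/(H' _ _ _ _ _ n n').
  - by move=> T x Rx; apply: ex'.
  exists t => T x z n; have [w n'] := ex' _ _ (name_sat quo n n).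
  by rewrite (Ht _ _ _ _ n n').
have arrK (P P' : mcat M) np np' (t : hom P P') (s : hom P' P) :
    is_quotient R (Q := P) np ->
    (forall T x (z : hom T P), np T x z -> np' T x (t ∘ z)) ->
    (forall T x (z : hom T P'), np' T x z -> np T x (s ∘ z)) -> s ∘ t = idm P.
  move=> quo Ht Hs; case: (quo) => _ co _ _.
  have [T [q [rq [x]]]] := co _ (idm P); rewrite comp1m => n.
  apply: (regular_epi_epi rq); rewrite comp1m -compA.
  exact: (name_uniq quo (Hs _ _ _ (Ht _ _ _ n)) n).
move=> quo quo'; have [t Ht] := arr _ _ _ _ quo quo'.
have [s Hs] := arr _ _ _ _ quo' quo.
by exists t; split=> //; exists s; split; [apply: arrK Ht Hs | apply: arrK Hs Ht].
Qed.

(** * The category of formulas *)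

Record nobj := NObj {
  carr : E;
  rel : form carr carr;
  rel_per : forall M, per M rel
}.

Definition qob (M : model) (c : nobj) : mcat M :=
  sval (cid (quotient_exists (@rel_per c M))).

Definition nm (M : model) (c : nobj) :
    forall T, hom T (mfun M (carr c)) -> hom T (qob M c) -> Prop :=
  sval (cid (svalP (cid (quotient_exists (@rel_per c M))))).
Arguments nm {M c T} _ _.

Lemma nmP (M : model) (c : nobj) : is_quotient (@rel c) (@nm M c).
Proof. exact: svalP (cid (svalP (cid (quotient_exists (@rel_per c M))))). Qed.

Lemma nm_stable M c T T' (x : hom T (mfun M (carr c))) z (p : hom T' T) :
  nm x z -> nm (x ∘ p) (z ∘ p).
Proof. by case: (nmP M c) => H _ _ _; apply: H. Qed.

Lemma nm_cover M c T (z : hom T (qob M c)) :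
  exists T' (q : hom T' T), regular_epi q /\ exists x, nm x (z ∘ q).
Proof. by case: (nmP M c). Qed.

Lemma nm_eq M c T (x x' : hom T (mfun M (carr c))) z z' :
  nm x z -> nm x' z' -> (sat (rel c) x x' <-> z = z').
Proof. by case: (nmP M c) => _ _ H _; apply: H. Qed.

Lemma nm_uniq M c T (x : hom T (mfun M (carr c))) z z' :
  nm x z -> nm x z' -> z = z'.
Proof. exact: (name_uniq (nmP M c)). Qed.

Lemma nm_sat M c T (x x' : hom T (mfun M (carr c))) z :
  nm x z -> nm x' z -> sat (rel c) x x'.
Proof. exact: (name_sat (nmP M c)). Qed.

Lemma sat_nm M c T (x x' : hom T (mfun M (carr c))) :
  sat (rel c) x x' -> exists z, nm x z /\ nm x' z.
Proof. exact: (sat_name (rel_per c M) (nmP M c)). Qed.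

Lemma nm_local M c T T' (x : hom T (mfun M (carr c))) z (q : hom T' T) :
  regular_epi q -> nm (x ∘ q) (z ∘ q) -> nm x z.
Proof. exact: (name_local (nmP M c)). Qed.

(** The domain of [rel c] is local, so an element that has a class after a cover has one already,
    and it restricts to [w] by uniqueness. *)
Lemma nm_sub_local M c T T' (x : hom T (mfun M (carr c))) (q : hom T' T) w :
  regular_epi q -> nm (x ∘ q) w -> exists z, nm x z /\ z ∘ q = w.
Proof.
move=> rq n; have [z [m _]] := sat_nm (sat_local rq (nm_sat n n)).
by exists z; split=> //; apply: nm_uniq (nm_stable q m) n.
Qed.

Lemma nm_cover2 M c d T (z : hom T (qob M c)) (w : hom T (qob M d)) :
  exists T' (q : hom T' T), regular_epi q /\
    exists x y, nm x (z ∘ q) /\ nm y (w ∘ q).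
Proof.
have [T1 [q1 [r1 [x n]]]] := nm_cover z.
have [T2 [q2 [r2 [y n']]]] := nm_cover (w ∘ q1).
exists T2, (q1 ∘ q2); split; first exact: regular_epi_comp.
by exists (x ∘ q2), y; rewrite !compA; split=> //; apply: nm_stable.
Qed.

Lemma qob_arrow_ext M c Z (f g : hom (qob M c) Z) :
  (forall T x (z : hom T (qob M c)), nm x z -> f ∘ z = g ∘ z) -> f = g.
Proof.
move=> H; have [T [q [rq [x n]]]] := nm_cover (idm (qob M c)).
by apply: (regular_epi_epi rq); apply: H; rewrite comp1m in n; exact: n.
Qed.

(** In this normal form [G] and [f] determine each other in [M], the formula up to equivalence.
    Equality of arrows thus becomes equivalence of formulas. *)
Definition rep (M : model) c d (G : form (carr c) (carr d))
    (f : hom (qob M c) (qob M d)) : Prop :=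
  forall T (x : hom T (mfun M (carr c))) (y : hom T (mfun M (carr d))),
    sat G x y <-> exists z, nm x z /\ nm y (f ∘ z).

(* Weaker than rep in that G may also relate elements that are not names. *)
Definition wrep (M : model) c d (G : form (carr c) (carr d))
    (f : hom (qob M c) (qob M d)) : Prop :=
  forall T (x : hom T (mfun M (carr c))) (y : hom T (mfun M (carr d))) z w,
    nm x z -> nm y w -> (sat G x y <-> f ∘ z = w).

Lemma rep_uniq M c d (G : form (carr c) (carr d))
    (f g : hom (qob M c) (qob M d)) : rep G f -> rep G g -> f = g.
Proof.
move=> rf rg; apply: qob_arrow_ext => T x z n.
have [T' [q [rq [y ny]]]] := nm_cover (f ∘ z).
apply: (regular_epi_epi rq).
have /rg [w [n1 n2]] : sat G (x ∘ q) y.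
  apply/rf; exists (z ∘ q); rewrite compA; split=> //; exact: nm_stable.
rewrite (nm_uniq n1 (nm_stable q n)) in n2.
by rewrite -(compA g); apply: nm_uniq ny n2.
Qed.

Lemma rep_names M c d (G : form (carr c) (carr d))
    (f : hom (qob M c) (qob M d)) T (x : hom T (mfun M (carr c))) y z w :
  rep G f -> nm x z -> nm y w -> (sat G x y <-> f ∘ z = w).
Proof.
move=> rf n n'; split=> [/rf [z' [n1 n2]] | E1].
  by rewrite (nm_uniq n n1); apply: nm_uniq n2 n'.
by apply/rf; exists z; rewrite E1.
Qed.

(** Composing with the two relations cuts [G] down to elements that have classes, and on those
    [wrep] already fixes it. *)
Lemma wrep_rep M c d (G : form (carr c) (carr d))
    (f : hom (qob M c) (qob M d)) :
  wrep G f -> rep (Comp (rel c) (Comp G (rel d))) f.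
Proof.
move=> wf T x y; split=> [|[z [n n']]].
  move=> [T1 [q1 [r1 [x' [Rx [T2 [q2 [r2 [y' [Gxy Ry]]]]]]]]]].
  have [w [n1 n2]] := sat_nm Rx; have [w' [n3 n4]] := sat_nm Ry.
  have Ef := (wf _ _ _ _ _ (nm_stable q2 n2) n3).1 Gxy.
  have [z [n5 Ez]] := nm_sub_local r1 n1; exists z; split=> //.
  apply: (nm_local r1); apply: (nm_local r2).
  by rewrite -Ef -Ez -!compA in n4; rewrite -!compA in n4 *.
apply: (sat_Comp (nm_sat n n)); apply: sat_Comp (nm_sat n' n').
by apply/(wf _ _ _ _ _ n n').
Qed.

Definition eqform X Y (G H : form X Y) : Prop :=
  forall (M : model) T (x : hom T (mfun M X)) y, sat G x y <-> sat H x y.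

(* An arrow is a class of formulas modulo equality in all models, rather
   than a family of arrows indexed by all models, which would be too large. *)
Definition nhom (c d : nobj) : Type :=
  {P : form (carr c) (carr d) -> Prop |
    exists G, (forall M, exists f, @rep M c d G f) /\ P = eqform G}.

Definition code c d (h : nhom c d) : form (carr c) (carr d) :=
  sval (cid (svalP h)).

Definition qar M c d (h : nhom c d) : hom (qob M c) (qob M d) :=
  sval (cid ((svalP (cid (svalP h))).1 M)).

Lemma rep_code M c d (h : nhom c d) : rep (code h) (qar M h).
Proof. exact: svalP (cid ((svalP (cid (svalP h))).1 M)). Qed.
Arguments rep_code M {c d} h.

Lemma sat_code M c d (h : nhom c d) T (x : hom T (mfun M (carr c))) y z w :
  nm x z -> nm y w -> (sat (code h) x y <-> qar M h ∘ z = w).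
Proof. exact: (rep_names (rep_code M h)). Qed.

Lemma eqform_eq X Y (G H : form X Y) : eqform G H -> eqform G = eqform H.
Proof.
move=> GH; apply: funext => K; apply: propext.
split=> e M T x y; first exact: (iff_trans (iff_sym (GH M T x y))).
exact: (iff_trans (GH M T x y)).
Qed.

(** Equal values in all models make the two codes equivalent in all models. The classes of formulas
    are then equal by extensionality, and the arrows by proof irrelevance. *)
Lemma qar_faithful c d (h k : nhom c d) : (forall M, qar M h = qar M k) -> h = k.
Proof.
move=> Ehk; have Es : sval h = sval k.
  rewrite /= (svalP (cid (svalP h))).2 (svalP (cid (svalP k))).2.
  apply: eqform_eq => M T x y.
  have rh := rep_code M h; rewrite Ehk in rh.
  exact: (iff_trans (rh T x y) (iff_sym (rep_code M k T x y))).
case: h k Es {Ehk} => P hP [P' hP'] /= Es; subst P'.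
by congr exist; apply: Prop_irrelevance.
Qed.

(** The device for building arrows: a single formula [G], fixed before the model, has to define in
    each model an arrow with the wanted property [P]. *)
Lemma qar_lift c d (G : form (carr c) (carr d))
    (P : forall M, hom (qob M c) (qob M d) -> Prop) :
  (forall M, exists f, wrep G f /\ P M f) ->
  exists h : nhom c d, forall M, P M (qar M h).
Proof.
move=> H; pose G' := Comp (rel c) (Comp G (rel d)).
have ex : exists G, (forall M, exists f, @rep M c d G f) /\ eqform G' = eqform G.
  by exists G'; split=> // M; have [f [/wrep_rep rf _]] := H M; exists f.
pose h : nhom c d := exist _ (eqform G') ex.
exists h => M; have [f [/wrep_rep rf Pf]] := H M.
have E1 : eqform G' = eqform (code h) by exact: (svalP (cid (svalP h))).2.
have e2 : eqform G' (code h) by rewrite E1 => N T x y.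
have rh : rep G' (qar M h).
  by move=> T x y; apply: (iff_trans (e2 M T x y)); apply: rep_code.
by rewrite (rep_uniq rh rf).
Qed.

Lemma nid_exists c : exists h : nhom c c, forall M, qar M h = idm (qob M c).
Proof.
apply: (qar_lift (G := rel c) (P := fun M f => f = idm _)) => M.
by exists (idm _); split=> // T x y z w n n'; rewrite comp1m; apply: nm_eq.
Qed.

Lemma ncomp_exists c d e (k : nhom d e) (h : nhom c d) :
  exists l : nhom c e, forall M, qar M l = qar M k ∘ qar M h.
Proof.
apply: (qar_lift (G := Comp (code h) (code k))
  (P := fun M f => f = qar M k ∘ qar M h)) => M.
exists (qar M k ∘ qar M h); split=> // T x y z w n n'; split.
  move=> [T' [q [rq [v [/(rep_code M h) [z' [n1 n2]]]]]]].
  rewrite (nm_uniq n1 (nm_stable q n)) in n2.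
  move/(sat_code _ n2 (nm_stable q n')) => E1.
  by apply: (regular_epi_epi rq); rewrite -!compA.
move=> Ew; have [T' [q [rq [v nv]]]] := nm_cover (qar M h ∘ z).
apply: (sat_local rq); apply: (sat_Comp (y := v)).
  by apply/(sat_code h (nm_stable q n) nv); rewrite compA.
by apply/(sat_code k nv (nm_stable q n')); rewrite -Ew !compA.
Qed.

Definition nid c : nhom c c := sval (cid (nid_exists c)).

Lemma qar_id M c : qar M (nid c) = idm (qob M c).
Proof. exact: (svalP (cid (nid_exists c))). Qed.

Definition ncomp c d e (k : nhom d e) (h : nhom c d) : nhom c e :=
  sval (cid (ncomp_exists k h)).

Lemma qar_comp M c d e (k : nhom d e) (h : nhom c d) :
  qar M (ncomp k h) = qar M k ∘ qar M h.
Proof. exact: (svalP (cid (ncomp_exists k h))). Qed.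

Definition ncat : category.
Proof.
refine (@Category nobj nhom nid ncomp _ _ _).
- by move=> c d h; apply: qar_faithful => M; rewrite qar_comp qar_id comp1m.
- by move=> c d h; apply: qar_faithful => M; rewrite qar_comp qar_id compm1.
- by move=> c d e f l k h; apply: qar_faithful => M; rewrite !qar_comp compA.
Defined.

(** * Evaluation at the models *)

Definition ev (M : model) : functor ncat (mcat M) :=
  @Functor ncat (mcat M) (qob M) (@qar M) (@qar_id M) (@qar_comp M).

Lemma ev_faithful (c d : ncat) (h k : hom c d) :
  (forall M, fmap (ev M) h = fmap (ev M) k) -> h = k.
Proof. exact: qar_faithful. Qed.

Lemma ev_mono (c d : ncat) (m : hom c d) :
  (forall M, mono (fmap (ev M) m)) -> mono m.
Proof.
move=> mm T u v E1; apply: ev_faithful => M; apply: mm.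
by rewrite -!fmapM E1.
Qed.

(** The formula saying that [a] x is related to y by [rel d] defines the arrow in every model at
    once. Projections of pullbacks and quotient maps arise in this way. *)
Lemma tracked (c d : nobj) (a : hom (carr c) (carr d)) :
  (forall M T (x x' : hom T (mfun M (carr c))), sat (rel c) x x' ->
     sat (rel d) (fmap (mfun M) a ∘ x) (fmap (mfun M) a ∘ x')) ->
  exists h : hom (c : ncat) d, forall M T (x : hom T (mfun M (carr c))) z,
    nm x z -> nm (fmap (mfun M) a ∘ x) (fmap (ev M) h ∘ z).
Proof.
move=> tr; apply: (qar_lift (G := Pull a (idm (carr d)) (rel d))
  (P := fun M f => forall T (x : hom T (mfun M (carr c))) z,
    nm x z -> nm (fmap (mfun M) a ∘ x) (f ∘ z))) => M.
have [|||f Hf] := functional_arrow (nmP M c)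
   (P := fun T x w => nm (fmap (mfun M) a ∘ x) w).
- by move=> T T' x w p /(nm_stable p); rewrite compA.
- by move=> T x x' w w' /tr Rx n n'; apply/(nm_eq n n').
- by move=> T x /tr /sat_nm [w [n _]]; exists w.
have {}Hf T (x : hom T (mfun M (carr c))) z :
    nm x z -> nm (fmap (mfun M) a ∘ x) (f ∘ z).
  move=> n; have /tr/sat_nm [w [n' _]] := nm_sat n n.
  by rewrite (Hf _ _ _ _ n n').
exists f; split=> // T x y z w n n'.
apply: (iff_trans (sat_Pull _ _ _ _ _)); rewrite fmap1 comp1m.
exact: nm_eq (Hf _ _ _ n) n'.
Qed.

Lemma sat_CompConv M c d e (f : nhom c e) (g : nhom d e) T
    (x : hom T (mfun M (carr c))) y :
  sat (Comp (code f) (Conv (code g))) x y <->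
  exists z w, [/\ nm x z, nm y w & qar M f ∘ z = qar M g ∘ w].
Proof.
split=> [[T' [q [rq [v [/(rep_code M f) [z1 [n1 n2]]]]]]] | [z [w [n n' E1]]]].
  move=> /(rep_code M g) [w1 [n3 n4]].
  have [z [n Ez]] := nm_sub_local rq n1; have [w [n' Ew]] := nm_sub_local rq n3.
  exists z, w; split=> //; apply: (regular_epi_epi rq).
  by rewrite -!compA Ez Ew; apply: nm_uniq n2 n4.
have [T' [q [rq [v nv]]]] := nm_cover (qar M f ∘ z).
apply: (sat_local rq); apply: (sat_Comp (y := v)).
  by apply/(sat_code f (nm_stable q n) nv); rewrite compA.
by apply/(sat_code g (nm_stable q n') nv); rewrite compA E1.
Qed.

Lemma sat_CompConv_names M c d e (f : nhom c e) (g : nhom d e) T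
    (x : hom T (mfun M (carr c))) y z w : nm x z -> nm y w ->
  (sat (Comp (code f) (Conv (code g))) x y <-> qar M f ∘ z = qar M g ∘ w).
Proof.
move=> n n'; apply: (iff_trans (sat_CompConv _ _ _ _)); split.
  by move=> [z' [w' [n1 n2]]]; rewrite (nm_uniq n n1) (nm_uniq n' n2).
by move=> E1; exists z, w.
Qed.

(** Factorizations found separately in each model come from one formula: as [m] is monic, the
    factorization sends x to the y with [f] x = [m] y. *)
Lemma ev_lift_mono (c d e : ncat) (m : hom d e) (f : hom c e) :
  (forall M, mono (fmap (ev M) m)) ->
  (forall M, mem (fmap (ev M) m) (fmap (ev M) f)) -> mem m f.
Proof.
move=> mm mf; have [M | h Hh] := @qar_lift c d (Comp (code f) (Conv (code m)))
   (fun M u => qar M m ∘ u = qar M f).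
  have [u Eu] := mf M; exists u; split=> // T x y z w n n'.
  apply: (iff_trans (sat_CompConv_names _ _ n n')); rewrite -[qar M f]Eu -compA.
  by split=> [/(mm M) | ->].
by exists h; apply: ev_faithful => M; rewrite fmapM; apply: Hh.
Qed.

Lemma ev_iso_reflect (c d : ncat) (h : hom c d) :
  (forall M, iso (fmap (ev M) h)) -> iso h.
Proof.
move=> ih; have mh M := iso_mono (ih M).
have [M | s Es] := @ev_lift_mono _ _ _ h (idm d) mh.
  by have [s [_ hs]] := ih M; exists s; rewrite fmap1.
by apply: mono_section_iso Es; apply: ev_mono.
Qed.

(** Dual to lifting along a monomorphism: the factorization relates z to w when some v has [q] v = z
    and [h] v = w. In each model this formula defines the descent of [h] along [q]. *)
Lemma ev_coequalizer_lift (c d e : ncat) (q : hom c d) (h : hom c e) :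
  (forall M, regular_epi (fmap (ev M) q)) ->
  (forall M T (u v : hom T (ev M c)), fmap (ev M) q ∘ u = fmap (ev M) q ∘ v ->
     fmap (ev M) h ∘ u = fmap (ev M) h ∘ v) ->
  exists! k : hom d e, k ∘ q = h.
Proof.
move=> rq Hh; have [M | k Hk] := @qar_lift d e (Comp (Conv (code q)) (code h))
   (fun M u => u ∘ qar M q = qar M h).
  have [k Ek] := regular_epi_descent (rq M) (Hh M).
  exists k; split=> // T x y z w n n'; split.
    move=> [T' [r [rr [v [/(rep_code M q) [z1 [n1 n2]]]]]]].
    move=> /(sat_code h n1 (nm_stable r n')) E1.
    apply: (regular_epi_epi rr); rewrite -E1 -[qar M h]Ek -!compA.
    by rewrite (nm_uniq n2 (nm_stable r n)).
  move=> Ew; have [T1 [r1 [u [c1 Eu]]]] := cover_pull (model_regular M) z (rq M).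
  rewrite /= in Eu; have [T2 [r2 [c2 [v nv]]]] := nm_cover u.
  apply: (sat_local c1); apply: (sat_local c2); apply: (sat_Comp (y := v)).
    apply/(sat_code q nv (nm_stable r2 (nm_stable r1 n))).
    by rewrite compA Eu.
  apply/(sat_code h nv (nm_stable r2 (nm_stable r1 n'))).
  have -> : w ∘ r1 = qar M h ∘ u.
    by rewrite -[qar M h]Ek -compA [qar M q ∘ u]Eu -Ew compA.
  by rewrite compA.
exists k; split; first by apply: ev_faithful => M; rewrite fmapM; apply: Hk.
move=> k' Ek'; apply: ev_faithful => M; apply: (regular_epi_epi (rq M)).
by rewrite -[RHS]fmapM Ek'; apply: Hk.
Qed.

(** * Constant objects and finite limits *)

Lemma sat_id (M : model) X T (x y : hom T (mfun M X)) :
  sat (Graph (idm X)) x y <-> x = y.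
Proof. by rewrite /= fmap1 comp1m. Qed.

Lemma per_id X M : per M (Graph (idm X)).
Proof.
split=> [T x y /sat_id -> | T x y z /sat_id -> /sat_id ->]; exact/sat_id.
Qed.

Definition nconst X : ncat := NObj (@per_id X).

Lemma quotient_id (M : model) X :
  is_quotient (Graph (idm X)) (fun T (x z : hom T (mfun M X)) => x = z).
Proof.
split.
- by move=> T T' x z p ->.
- by move=> T z; exists T, (idm T); split=> //; exists (z ∘ idm T).
- by move=> T x x' z z' -> ->; exact: sat_id.
- by move=> T x _; exists x.
Qed.

Definition eta M X : hom (ev M (nconst X)) (mfun M X) :=
  sval (cid (quotient_comparison (nmP M (nconst X)) (quotient_id M X))).

Lemma eta_iso M X : iso (eta M X).
Proof.
by case: (svalP (cid (quotient_comparison (nmP M (nconst X)) (quotient_id M X)))).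
Qed.

Lemma nm_const M X T (x : hom T (mfun M X)) (z : hom T (ev M (nconst X))) :
  @nm M (nconst X) T x z <-> eta M X ∘ z = x.
Proof.
have to T' (x' : hom T' (mfun M X)) (z' : hom T' (ev M (nconst X))) :
    @nm M (nconst X) T' x' z' -> eta M X ∘ z' = x'.
  by move: (svalP (cid (quotient_comparison (nmP M (nconst X)) (quotient_id M X))))
    => [_ H] /H.
split=> [/to // | <-]; have [T' [q [rq [x' n]]]] := nm_cover z.
by apply: (nm_local rq); rewrite -compA (to _ _ _ n).
Qed.

Lemma cfun_exists X Y (f : hom X Y) :
  exists h : hom (nconst X) (nconst Y), forall M,
    eta M Y ∘ fmap (ev M) h = fmap (mfun M) f ∘ eta M X.
Proof.
have [M T x x' /sat_id -> | h Hh] := @tracked (nconst X) (nconst Y) f.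
  exact/sat_id.
exists h => M; have n := (nm_const (eta M X) (idm _)).2 (compm1 _).
by have /nm_const := Hh _ _ _ _ n; rewrite compm1.
Qed.

Definition cmap X Y (f : hom X Y) : hom (nconst X) (nconst Y) :=
  sval (cid (cfun_exists f)).

Lemma eta_natural M X Y (f : hom X Y) :
  eta M Y ∘ fmap (ev M) (cmap f) = fmap (mfun M) f ∘ eta M X.
Proof. exact: (svalP (cid (cfun_exists f))). Qed.

Definition cfun : functor E ncat.
Proof.
refine (@Functor E ncat nconst cmap _ _).
- move=> X; apply: ev_faithful => M; apply: (iso_mono (eta_iso M X)).
  by rewrite eta_natural !fmap1 comp1m compm1.
- move=> X Y Z g f; apply: ev_faithful => M; apply: (iso_mono (eta_iso M Z)).
  by rewrite eta_natural !fmapM compA eta_natural -!compA eta_natural.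
Defined.

Definition eta_nat M : nat_iso (fcomp (ev M) cfun) (mfun M) :=
  @NatIso _ _ (fcomp (ev M) cfun) (mfun M) (eta M) (eta_natural M) (eta_iso M).

Lemma mfun_limits (M : model) : preserves_finite_limits (mfun M).
Proof. by case: (mfun_regular M). Qed.

Lemma ev_cfun_terminal M X : is_terminal X -> is_terminal (ev M (cfun X)).
Proof.
by move=> hX; apply: (nat_iso_terminal (eta_nat M)); apply: (mfun_limits M).1.
Qed.

Lemma cfun_terminal X : is_terminal X -> is_terminal (cfun X).
Proof.
move=> hX c; have [a _] := hX (carr c).
have [M T x x' _ | h _] := @tracked c (cfun X) a.
  exact/sat_id/terminal_uniq/(mfun_limits M).1.
exists h => h'; apply: ev_faithful => M.
exact/terminal_uniq/ev_cfun_terminal.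
Qed.

Lemma ev_terminal M (c : ncat) : is_terminal c -> is_terminal (ev M c).
Proof.
move=> hc; have [[X hX] _] := limE.
have [f fi] := terminal_iso hc (cfun_terminal hX).
exact: iso_terminal (fmap_iso (ev M) fi) (ev_cfun_terminal hX).
Qed.

Section Pullback.
Variables (c d e : nobj) (f : nhom c e) (g : nhom d e).
Variables (B : E) (p1 : hom B (carr c)) (p2 : hom B (carr d)).

(** [B] will be the product of the two carriers. Pairs are related when they are so componentwise
    and their classes agree in [e]; given the first two conjuncts, the third depends only on the
    classes. *)
Definition pb_rel : form B B :=
  Meet (Meet (Pull p1 p1 (rel c)) (Pull p2 p2 (rel d)))
       (Pull p1 p2 (Comp (code f) (Conv (code g)))).

Lemma sat_pb_rel M T (b b' : hom T (mfun M B)) :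
  sat pb_rel b b' <-> exists z w,
    [/\ nm (fmap (mfun M) p1 ∘ b) z /\ nm (fmap (mfun M) p1 ∘ b') z,
        nm (fmap (mfun M) p2 ∘ b) w /\ nm (fmap (mfun M) p2 ∘ b') w
      & qar M f ∘ z = qar M g ∘ w].
Proof.
split=> [/sat_Meet [/sat_Meet [/sat_Pull Rc /sat_Pull Rd] /sat_Pull Rfg] |
         [z [w [[n1 n2] [n3 n4] E1]]]].
  have [z [n1 n2]] := sat_nm Rc; have [w [n3 n4]] := sat_nm Rd.
  by move/(sat_CompConv_names _ _ n1 n4): Rfg => E1; exists z, w.
apply/sat_Meet; split; [apply/sat_Meet; split|]; apply/sat_Pull.
- exact: nm_sat n1 n2.
- exact: nm_sat n3 n4.
- exact/(sat_CompConv_names _ _ n1 n4).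
Qed.

Lemma per_pb_rel M : per M pb_rel.
Proof.
split=> [T b b' /sat_pb_rel [z [w [[n1 n2] [n3 n4] E1]]] |
  T b b' b'' /sat_pb_rel [z [w [[n1 n2] [n3 n4] E1]]]].
  by apply/sat_pb_rel; exists z, w.
move=> /sat_pb_rel [z' [w' [[m1 m2] [m3 m4] _]]].
apply/sat_pb_rel; exists z, w.
by rewrite {2}(nm_uniq n2 m1) {2}(nm_uniq n4 m3).
Qed.

End Pullback.

(** The universal property is proved first in every model, and the mediating arrow in [ncat] is then
    given by a formula. Having both for the same square lets preservation and reflection of
    pullbacks follow by comparison with it. *)
Lemma ncat_pullback (c d e : ncat) (f : hom c e) (g : hom d e) :
  exists P (p : hom P c) (q : hom P d), is_pullback f g p q /\
    forall M, is_pullback (fmap (ev M) f) (fmap (ev M) g)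
                          (fmap (ev M) p) (fmap (ev M) q).
Proof.
have [B [p1 [p2 [O [x [y [hO pb]]]]]]] := binary_product limE (carr c) (carr d).
have pair (M : model) T (a : hom T (mfun M (carr c))) (b : hom T (mfun M (carr d))) :
    exists h, fmap (mfun M) p1 ∘ h = a /\ fmap (mfun M) p2 ∘ h = b.
  have [|h [Eh _]] := ((mfun_limits M).2 _ _ _ _ _ _ _ _ pb).2 _ a b.
    exact/terminal_uniq/(mfun_limits M).1.
  by exists h.
pose P : ncat := NObj (@per_pb_rel c d e f g B p1 p2).
have [M T b b' /sat_pb_rel [z [w [[n1 n2] _ _]]] | p Hp] := @tracked P c p1.
  exact: nm_sat n1 n2.
have [M T b b' /sat_pb_rel [z [w [_ [n1 n2] _]]] | q Hq] := @tracked P d p2.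
  exact: nm_sat n1 n2.
have sq M : fmap (ev M) f ∘ fmap (ev M) p = fmap (ev M) g ∘ fmap (ev M) q.
  apply: qob_arrow_ext => T b z n; rewrite -!compA.
  have /sat_pb_rel [v [w [[n1 _] [n2 _] E1]]] := nm_sat n n.
  by rewrite -(nm_uniq n1 (Hp _ _ _ _ n)) -(nm_uniq n2 (Hq _ _ _ _ n)).
have jm M T (u v : hom T (ev M P)) : fmap (ev M) p ∘ u = fmap (ev M) p ∘ v ->
    fmap (ev M) q ∘ u = fmap (ev M) q ∘ v -> u = v.
  move=> E1 E2; have [T' [r [rr [b [b' [n n']]]]]] := nm_cover2 u v.
  apply: (regular_epi_epi rr); apply/(nm_eq n n')/sat_pb_rel.
  exists (fmap (ev M) p ∘ u ∘ r), (fmap (ev M) q ∘ u ∘ r); split.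
  - by split; [rewrite -compA; apply: Hp | rewrite E1 -compA; apply: Hp].
  - by split; [rewrite -compA; apply: Hq | rewrite E2 -compA; apply: Hq].
  - by rewrite !compA [qar M f ∘ _]sq.
have pbM M : is_pullback (fmap (ev M) f) (fmap (ev M) g)
                         (fmap (ev M) p) (fmap (ev M) q).
  split=> // T z w E1.
  have [T' [r [rr [a [b [n n']]]]]] := nm_cover2 z w.
  have [h [Ea Eb]] := pair M _ a b.
  have /sat_nm [v [nv _]] : sat (rel P) h h.
    apply/sat_pb_rel; exists (z ∘ r), (w ∘ r); rewrite Ea Eb; split=> //.
    by rewrite !compA [qar M f ∘ _]E1.
  have Ev1 := nm_uniq (Hp _ _ _ _ nv); rewrite Ea in Ev1; have {}Ev1 := Ev1 _ n.
  have Ev2 := nm_uniq (Hq _ _ _ _ nv); rewrite Eb in Ev2; have {}Ev2 := Ev2 _ n'.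
  (* [v] lives only over the cover [r]; joint monicity of the projections makes it descend. *)
  have [|u Eu] := regular_epi_descent (x := v) rr.
    move=> S s t Est; apply: jm; rewrite !compA ?Ev1 ?Ev2 -!compA; by rewrite Est.
  exists u; split; last by move=> u' [F1 F2]; apply: jm; rewrite ?F1 ?F2;
    apply: (regular_epi_epi rr); rewrite -compA Eu.
  by split; apply: (regular_epi_epi rr); rewrite -compA Eu.
exists P, p, q; split=> //; split.
  by apply: ev_faithful => M; rewrite !fmapM.
move=> t u v Euv.
(* The formula relates b to those b' whose first component is a value of [u] at b and whose second
   is a value of [v] at b. *)
have [M | h Hh] := @qar_lift t P
    (Meet (Pull (idm _) p1 (code u)) (Pull (idm _) p2 (code v)))
    (fun M k => qar M p ∘ k = qar M u /\ qar M q ∘ k = qar M v).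
  have [|k [[Ek1 Ek2] _]] := (pbM M).2 _ (fmap (ev M) u) (fmap (ev M) v).
    by rewrite -!fmapM Euv.
  exists k; split=> // T b b' z w n n'.
  have sP1 : sat (Pull (idm _) p1 (code u)) b b' <-> qar M p ∘ (k ∘ z) = qar M p ∘ w.
    apply: (iff_trans (sat_Pull _ _ _ _ _)); rewrite fmap1 comp1m compA [qar M p ∘ k]Ek1.
    exact: sat_code (Hp _ _ _ _ n').
  have sP2 : sat (Pull (idm _) p2 (code v)) b b' <-> qar M q ∘ (k ∘ z) = qar M q ∘ w.
    apply: (iff_trans (sat_Pull _ _ _ _ _)); rewrite fmap1 comp1m compA [qar M q ∘ k]Ek2.
    exact: sat_code (Hq _ _ _ _ n').
  split=> [/sat_Meet [/sP1 F1 /sP2 F2] | Ew]; first exact: jm.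
  by apply/sat_Meet; split; [apply/sP1 | apply/sP2]; rewrite -Ew.
exists h; split.
  by split; apply: ev_faithful => M; rewrite fmapM; case: (Hh M).
move=> h' [F1 F2]; apply: ev_faithful => M; apply: (pullback_ext (pbM M)).
  by rewrite -[RHS]fmapM F1; case: (Hh M).
by rewrite -[RHS]fmapM F2; case: (Hh M).
Qed.

Lemma ev_pullback M (X Y Z P : ncat) (f : hom X Z) (g : hom Y Z) (p : hom P X)
    (q : hom P Y) : is_pullback f g p q ->
  is_pullback (fmap (ev M) f) (fmap (ev M) g) (fmap (ev M) p) (fmap (ev M) q).
Proof.
move=> pb; have [P' [p' [q' [pb' pbM]]]] := ncat_pullback f g.
have [k [<- <- ik]] := pullback_comparison pb' pb.
by rewrite !fmapM; apply: pullback_iso => //; apply: fmap_iso.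
Qed.

Lemma ev_limits M : preserves_finite_limits (ev M).
Proof. by split=> [c | X Y Z P f g p q]; [exact: ev_terminal | exact: ev_pullback]. Qed.

(** The comparison arrow into the constructed pullback evaluates in each model to the comparison of
    two pullbacks, so it is an isomorphism in all models and hence in [ncat]. *)
Lemma ev_pullback_reflect (X Y Z P : ncat) (f : hom X Z) (g : hom Y Z)
    (p : hom P X) (q : hom P Y) :
  (forall M, is_pullback (fmap (ev M) f) (fmap (ev M) g)
                         (fmap (ev M) p) (fmap (ev M) q)) ->
  is_pullback f g p q.
Proof.
move=> pbM; have [P' [p' [q' [pb' pbM']]]] := ncat_pullback f g.
have [|k [[Ek1 Ek2] _]] := pb'.2 _ p q.
  by apply: ev_faithful => M; rewrite !fmapM (pbM M).1.
rewrite -Ek1 -Ek2; apply: pullback_iso => //; apply: ev_iso_reflect => M.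
have [l [El1 El2 il]] := pullback_comparison (pbM' M) (pbM M).
suff -> : fmap (ev M) k = l by [].
by apply: (pullback_ext (pbM' M)); rewrite ?El1 ?El2 -fmapM ?Ek1 ?Ek2.
Qed.

Lemma ncat_limits : has_finite_limits ncat.
Proof.
split=> [|X Y Z f g].
  by have [[X hX] _] := limE; exists (cfun X); apply: cfun_terminal.
by have [P [p [q [pb _]]]] := ncat_pullback f g; exists P, p, q.
Qed.

(** * Exactness *)

(** The quotient keeps the carrier and replaces the relation by the coarser [K]; the identity of the
    carrier tracks the projection. As [K] has the domain of [rel c], every name of a class of [K]
    also names an element of [c], so the projection is a cover. *)
Lemma ncat_quotient (c : nobj) (K : form (carr c) (carr c)) :
  (forall M, per M K) ->
  (forall M T (x y : hom T (mfun M (carr c))), sat (rel c) x y -> sat K x y) ->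
  (forall M T (x : hom T (mfun M (carr c))), sat K x x -> sat (rel c) x x) ->
  exists (Q : ncat) (e : hom (c : ncat) Q), forall M,
    regular_epi (fmap (ev M) e) /\
    forall T (x y : hom T (mfun M (carr c))) z w, nm x z -> nm y w ->
      (sat K x y <-> fmap (ev M) e ∘ z = fmap (ev M) e ∘ w).
Proof.
move=> perK RK KR; pose Q := NObj perK.
have [M T x x' | e He] := @tracked c Q (idm _).
  by rewrite fmap1 !comp1m; apply: RK.
have {}He M T (x : hom T (mfun M (carr c))) z : nm x z ->
    @nm M Q T x (fmap (ev M) e ∘ z).
  by move=> /He; rewrite fmap1 comp1m.
exists Q, e => M; split=> [|T x y z w n n'].
  apply: cover_lift => // T w; have [T' [q [rq [x n]]]] := nm_cover w.
  exists T', q; split=> //.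
  have /KR/sat_nm [z [nz _]] := nm_sat n n; exists z.
  exact: nm_uniq (He _ _ _ _ nz) n.
exact: nm_eq (He _ _ _ _ n) (He _ _ _ _ n').
Qed.

Lemma kernel_quotient (c d : ncat) (f : hom c d) :
  exists (Q : ncat) (e : hom c Q), forall M,
    regular_epi (fmap (ev M) e) /\
    forall T (z w : hom T (ev M c)),
      fmap (ev M) f ∘ z = fmap (ev M) f ∘ w <->
      fmap (ev M) e ∘ z = fmap (ev M) e ∘ w.
Proof.
have [M | M T x y Rxy | M T x | Q [e He]] :=
    @ncat_quotient c (Comp (code f) (Conv (code f))).
- split=> [T x y /sat_CompConv [z [w [n n' E1]]] |
           T x y v /sat_CompConv [z [w [n n' E1]]]].
    by apply/sat_CompConv; exists w, z.
  move=> /sat_CompConv [z' [w' [m m' E2]]].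
  by apply/sat_CompConv; exists z, w'; rewrite E1 -E2 (nm_uniq n' m).
- have [z [n n']] := sat_nm Rxy.
  by apply/sat_CompConv; exists z, z.
- by move=> /sat_CompConv [z [w [n _ _]]]; exact: (nm_sat n n).
exists Q, e => M; have [re He'] := He M; split=> // T z w.
have [T' [q [rq [x [y [n n']]]]]] := nm_cover2 z w.
have /= H1 := He' _ _ _ _ _ n n'; have H2 := sat_CompConv_names f f n n'.
split=> E1.
  apply: (regular_epi_epi rq); rewrite -!compA; apply/H1/H2.
  by rewrite !compA [qar M f ∘ z]E1.
apply: (regular_epi_epi rq); rewrite -!compA; apply/H2/H1.
by rewrite !compA [qar M e ∘ z]E1.
Qed.

(** In every model the projection [e] identifies the same elements as [f], namely those related by
    [p] and [q]. So an arrow that coequalizes [p] and [q] descends in each model, and by a uniform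
    formula in [ncat]. *)
Lemma ncat_kernel_coequalizer (X Y R : ncat) (f : hom X Y) (p q : hom R X) :
  is_pullback f f p q -> exists (Q : ncat) (e : hom X Q),
    is_coequalizer p q e /\ forall M, regular_epi (fmap (ev M) e).
Proof.
move=> pb; have [Q [e He]] := kernel_quotient f; exists Q, e.
split=> [|M]; last by case: (He M).
split=> [|Z h hpq].
  apply: ev_faithful => M; rewrite !fmapM; apply/(He M).2.
  exact: (ev_pullback M pb).1.
apply: ev_coequalizer_lift => [M | M T u v /(He M).2]; first by case: (He M).
move=> /(ev_pullback M pb).2 [w [[<- <-] _]].
by rewrite !compA -!fmapM hpq.
Qed.

(** [f] and the constructed quotient [e] are coequalizers of the same kernel pair, so they differ by
    an isomorphism, and [e] is a regular epimorphism in every model. *)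
Lemma ev_regular_epi M (X Y : ncat) (f : hom X Y) :
  regular_epi f -> regular_epi (fmap (ev M) f).
Proof.
move=> rf; have [P [p [q [pb _]]]] := ncat_pullback f f.
have [Q [e [ce re]]] := ncat_kernel_coequalizer pb.
have cf := kernel_pair_coequalizer pb rf.
have [k [Ek _]] := ce.2 _ f cf.1.
have [l [El _]] := cf.2 _ e ce.1.
have ik : iso k.
  exists l; split.
    by apply: (regular_epi_epi (e := e)); [exists P, p, q | rewrite -compA Ek El comp1m].
  by apply: (regular_epi_epi rf); rewrite -compA El Ek comp1m.
by rewrite -Ek fmapM; apply: regular_epi_iso_comp => //; apply: fmap_iso.
Qed.

Lemma ev_regular_epi_reflect (X Y : ncat) (f : hom X Y) :
  (forall M, regular_epi (fmap (ev M) f)) -> regular_epi f.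
Proof.
move=> rf; have [P [p [q [pb pbM]]]] := ncat_pullback f f.
exists P, p, q; split=> [|Z h hpq]; first exact: pb.1.
apply: ev_coequalizer_lift => // M T u v /(pbM M).2 [w [[<- <-] _]].
by rewrite !compA -!fmapM hpq.
Qed.

Lemma ncat_regular : regular ncat.
Proof.
split; first exact: ncat_limits.
- by move=> X Y R f p q /ncat_kernel_coequalizer [Q [e [ce _]]]; exists Q, e.
- move=> X Y Z P f g p q pb rf; apply: ev_regular_epi_reflect => M.
  have [_ _ st] := model_regular M.
  exact: st (ev_pullback M pb) (ev_regular_epi M rf).
Qed.

Lemma ev_regular M : regular_functor (ev M).
Proof. by split; [exact: ev_limits | move=> X Y e; exact: ev_regular_epi]. Qed.

Lemma cfun_regular : regular_functor cfun.
Proof.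
split; first split.
- exact: cfun_terminal.
- move=> X Y Z P f g p q pb; apply: ev_pullback_reflect => M.
  by apply: (nat_iso_pullback (eta_nat M)); apply: (mfun_limits M).2.
- move=> X Y e re; apply: ev_regular_epi_reflect => M.
  apply: (nat_iso_regular_epi (eta_nat M)) => //.
  by case: (mfun_regular M) => _; apply.
Qed.

(** The formula [K] expresses [R] on names, and [e] is the quotient by [K]. The comparison [k] of
    [R] with the kernel pair of [e] is monic because [l] and [r] are jointly monic, and a regular
    epimorphism because it is a cover in each model. *)
Lemma ncat_exact : exact ncat.
Proof.
split=> [|R X l r [jm re sy tr]]; first exact: ncat_regular.
(* Elements of [ev M X] need not come from [ncat], so each axiom is applied to generic elements
   ([idm X], the pair [l] and [r], the pullback of [r] and [l]) and the resulting arrow is evaluated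
   at [M]. *)
have rE M T (z : hom T (ev M X)) :
    exists u, fmap (ev M) l ∘ u = z /\ fmap (ev M) r ∘ u = z.
  have [i [E1 E2]] := re _ (idm X); exists (fmap (ev M) i ∘ z).
  by rewrite !compA -!fmapM E1 E2 fmap1 comp1m.
have sE M T (u : hom T (ev M R)) : exists v,
    fmap (ev M) l ∘ v = fmap (ev M) r ∘ u /\ fmap (ev M) r ∘ v = fmap (ev M) l ∘ u.
  have [|s [E1 E2]] := sy _ l r; first by exists (idm R); rewrite !compm1.
  by exists (fmap (ev M) s ∘ u); rewrite !compA -!fmapM E1 E2.
have tE M T (u v : hom T (ev M R)) : fmap (ev M) r ∘ u = fmap (ev M) l ∘ v ->
    exists w, fmap (ev M) l ∘ w = fmap (ev M) l ∘ u /\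
              fmap (ev M) r ∘ w = fmap (ev M) r ∘ v.
  have [P [p [q [pb pbM]]]] := ncat_pullback r l.
  move=> /(pbM M).2 [w [[<- <-] _]].
  have [||t [E1 E2]] := tr _ (l ∘ p) (r ∘ p) (r ∘ q).
  - by exists p.
  - by exists q; rewrite pb.1.
  by exists (fmap (ev M) t ∘ w); rewrite !compA -!fmapM E1 E2.
pose K := Comp (Conv (code l)) (code r).
have KE M T (x y : hom T (mfun M (carr X))) : sat K x y <->
    exists T' (q : hom T' T), regular_epi q /\ exists u,
      nm (x ∘ q) (fmap (ev M) l ∘ u) /\ nm (y ∘ q) (fmap (ev M) r ∘ u).
  split=> [[T' [q [rq [v [/(rep_code M l) [u [n1 n2]]]]]]] | [T' [q [rq [u [n1 n2]]]]]].
    move=> /(rep_code M r) [u' [n3 n4]]; exists T', q; split=> //; exists u.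
    by rewrite (nm_uniq n1 n3) in n2 *.
  have [T2 [q2 [rq2 [v nv]]]] := nm_cover u.
  apply: (sat_local rq); apply: (sat_local rq2); apply: (sat_Comp (y := v)).
    by apply/(sat_code l nv (nm_stable q2 n1)); rewrite compA.
  by apply/(sat_code r nv (nm_stable q2 n2)); rewrite compA.
have [M | M T x y Rxy | M T x | Q [e He]] := @ncat_quotient X K.
- split=> [T x y /KE [T' [q [rq [u [n1 n2]]]]] | T x y z /KE [T1 [q1 [r1 [u [n1 n2]]]]]].
    have [v [E1 E2]] := sE M _ u.
    by apply/KE; exists T', q; split=> //; exists v; rewrite E1 E2.
  move=> /KE [T2 [q2 [r2 [v [n3 n4]]]]].
  have [S [s1 [s2 [rs Es]]]] := cover2 (model_regular M) r1 r2.
  have [|w [E1 E2]] := tE M _ (u ∘ s1) (v ∘ s2).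
    rewrite !compA; apply: nm_uniq (nm_stable s1 n2) _.
    by rewrite -compA Es compA; apply: nm_stable.
  apply/KE; exists S, (q1 ∘ s1); split=> //; exists w; rewrite E1 E2 {2}Es !compA.
  by split; apply: nm_stable.
- have [z [n n']] := sat_nm Rxy; have [u [E1 E2]] := rE M _ z.
  by apply/KE; exists T, (idm T); split=> //; exists u; rewrite !compm1 E1 E2.
- move=> /KE [T' [q [rq [u [n _]]]]].
  exact: sat_local rq (nm_sat n n).
have HQ M T (z w : hom T (ev M X)) :
    fmap (ev M) e ∘ z = fmap (ev M) e ∘ w ->
    exists T' (q : hom T' T), regular_epi q /\
    exists u, fmap (ev M) l ∘ u = z ∘ q /\ fmap (ev M) r ∘ u = w ∘ q.
  move=> E1; have [T1 [q1 [r1 [x [y [n n']]]]]] := nm_cover2 z w.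
  have /KE [T2 [q2 [r2 [u [n1 n2]]]]] : sat K x y.
    by apply/((He M).2 _ _ _ _ _ n n'); rewrite !compA E1.
  exists T2, (q1 ∘ q2); split; first exact: regular_epi_comp.
  exists u; rewrite !compA.
  by split; [apply: nm_uniq n1 (nm_stable q2 n) | apply: nm_uniq n2 (nm_stable q2 n')].
have sq : e ∘ l = e ∘ r.
  apply: ev_faithful => M; rewrite !fmapM; apply: qob_arrow_ext => T a u n.
  have [T' [q [rq [x [y [n1 n2]]]]]] :=
    nm_cover2 (fmap (ev M) l ∘ u) (fmap (ev M) r ∘ u).
  apply: (regular_epi_epi rq); rewrite -!(compA (fmap (ev M) e)).
  apply/((He M).2 _ _ _ _ _ n1 n2)/KE; exists T', (idm T').
  by split=> //; exists (u ∘ q); rewrite !compm1 !compA.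
have [P [p [q [pb pbM]]]] := ncat_pullback e e.
have [k [[Ek1 Ek2] _]] := pb.2 _ l r sq.
exists Q, e; rewrite -Ek1 -Ek2; apply: pullback_iso => //.
apply: regular_epi_mono_iso; last first.
  by move=> T u v Euv; apply: jm; rewrite -?Ek1 -?Ek2 -!compA Euv.
apply: ev_regular_epi_reflect => M; apply: cover_lift => // T y.
have [|T' [c [rc [u [E1 E2]]]]] :=
    HQ M _ (fmap (ev M) p ∘ y) (fmap (ev M) q ∘ y).
  by rewrite !compA (pbM M).1.
exists T', c; split=> //; exists u; apply: (pullback_ext (pbM M)).
  by rewrite !compA -fmapM Ek1.
by rewrite !compA -fmapM Ek2.
Qed.


(** * The generic filter *)

Lemma per_Fil M : per M Fil.
Proof.
split=> [T x y [<- mx] | T x y z [<- mx] [<- _]]; by split.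
Qed.

Definition nfil : ncat := NObj per_Fil.

(** Up to [eta], the inclusion evaluates in each model to the filter of that model; the second
    clause says so on elements. *)
Lemma nfil_incl_exists : exists d : hom nfil (cfun A), forall M,
  mono (fmap (ev M) d) /\ forall T (z : hom T (ev M (cfun A))),
    mem (fmap (ev M) d) z <-> mem (mfil_incl M) (eta M A ∘ z).
Proof.
have [M T x x' [<- _] | d Hd] := @tracked nfil (cfun A) (idm _).
  exact/sat_id.
have {}Hd M T (x : hom T (mfun M A)) (z : hom T (ev M nfil)) :
    @nm M nfil T x z -> eta M A ∘ (fmap (ev M) d ∘ z) = x.
  by move=> /Hd /nm_const ->; rewrite fmap1 comp1m.
have md M : mono (fmap (ev M) d).
  move=> T u v Euv; have [T' [q [rq [x [y [n n']]]]]] := nm_cover2 u v.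
  apply: (regular_epi_epi rq); rewrite -(nm_eq n n').
  have [_ mx] : sat Fil x x by apply: (nm_sat n n).
  by split=> //; rewrite -(Hd _ _ _ _ n) -(Hd _ _ _ _ n') !(compA _ _ q) Euv.
exists d => M; split=> // T z; split=> [[u <-] | mz].
  have [T' [q [rq [x n]]]] := nm_cover u.
  apply: (mem_cover (@mfil_mono M) rq).
  have [_] : sat Fil x x by apply: (nm_sat n n).
  by rewrite -!compA (Hd _ _ _ _ n).
have /sat_nm [u [n _]] : sat (rel nfil) (eta M A ∘ z) (eta M A ∘ z) by [].
by exists u; apply: (iso_mono (eta_iso M A)); apply: Hd.
Qed.

Definition nfil_incl : hom nfil (cfun A) := sval (cid nfil_incl_exists).

Lemma ev_nfil_mono M : mono (fmap (ev M) nfil_incl).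
Proof. by case: (svalP (cid nfil_incl_exists) M). Qed.

Lemma mem_nfil M T (z : hom T (ev M (cfun A))) :
  mem (fmap (ev M) nfil_incl) z <-> mem (mfil_incl M) (eta M A ∘ z).
Proof. by case: (svalP (cid nfil_incl_exists) M). Qed.

Lemma eta_rel2 M R X Y (l : hom R X) (r : hom R Y) (T : ncat)
    (x : hom T (cfun X)) (y : hom T (cfun Y)) :
  rel2 (fmap cfun l) (fmap cfun r) x y ->
  rel2 (fmap (mfun M) l) (fmap (mfun M) r)
    (eta M X ∘ fmap (ev M) x) (eta M Y ∘ fmap (ev M) y).
Proof.
move=> [u [<- <-]]; exists (eta M R ∘ fmap (ev M) u).
by rewrite !compA -!(eta_natural M) -!compA -!fmapM.
Qed.

(** Membership lifts from the models because the inclusion is monic in each, so the closure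
    conditions come from the filters of the models. The intersection condition does too, because
    regular epimorphisms are reflected. *)
Lemma nfil_filter : is_filter (AA := AA) (F := cfun) nfil_incl.
Proof.
have lift T (x : hom T (cfun A)) :
    (forall M, mem (mfil_incl M) (eta M A ∘ fmap (ev M) x)) -> mem nfil_incl x.
  move=> mx; apply: ev_lift_mono => M; first exact: ev_nfil_mono.
  exact/mem_nfil.
have mem_ev M T (x : hom T (cfun A)) : mem nfil_incl x ->
    mem (mfil_incl M) (eta M A ∘ fmap (ev M) x).
  by move=> [u <-]; apply/mem_nfil; exists (fmap (ev M) u); rewrite fmapM.
split.
- by apply: ev_mono => M; apply: ev_nfil_mono.
- move=> T x y mx lexy; apply: lift => M.
  have [_ up _ _] := mfil_filter M.
  exact: up (mem_ev M _ _ mx) (eta_rel2 M lexy).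
- move=> T x y z mx my [u [Ex Ey Ez]]; apply: lift => M.
  have [_ _ cl _] := mfil_filter M.
  apply: cl (mem_ev M _ _ mx) (mem_ev M _ _ my) _.
  exists (eta M _ ∘ fmap (ev M) u).
  by rewrite !compA -!(eta_natural M) -!compA -!fmapM Ex Ey Ez.
- move=> U m mm im; have [P [p [q [pb pbM]]]] := ncat_pullback (fmap cfun m) nfil_incl.
  exists P, p, q; split=> //.
  have [[O hO] _] := limE; have hO' := cfun_terminal hO.
  have [t _] := hO' P; exists (cfun O), t; split=> //.
  apply: ev_regular_epi_reflect => M.
  apply: inhabited_terminal => //; last exact: ev_cfun_terminal.
  have [_ _ _ /(_ U m mm im)] := mfil_filter M.
  move=> [P' [p' [q' [pb' inh]]]].
  have [j [_ ej]] := cpt_iso (eta_nat M) U; rewrite /= in ej.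
  (* The inhabited intersection in [M] maps into the evaluated pullback, which is therefore
     inhabited. *)
  have [y Ey] : mem (fmap (ev M) nfil_incl) (fmap (ev M) (fmap cfun m) ∘ (j ∘ p')).
    apply/mem_nfil; exists q'; rewrite -pb'.1 compA (eta_natural M).
    by rewrite -compA (compA _ j) ej comp1m.
  have [k _] := (pbM M).2 _ _ _ (esym Ey).
  exact: (inhabited_codomain (model_regular M) k).
Qed.

Definition nmodel : model :=
  ExactModel ncat_exact cfun_regular nfil_filter.

Lemma ev_filter M : exists k : hom (ev M nfil) (mfil M),
  iso k /\ mfil_incl M ∘ k = eta M A ∘ fmap (ev M) nfil_incl.
Proof.
have [k Ek] : mem (mfil_incl M) (eta M A ∘ fmap (ev M) nfil_incl).
  by apply/mem_nfil; exists (idm _); rewrite compm1.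
have [j [_ ej]] := eta_iso M A.
exists k; split=> //; apply: mem_iso Ek _ => //.
  by apply: mono_comp (@ev_nfil_mono M); apply/iso_mono/eta_iso.
have [u Eu] : mem (fmap (ev M) nfil_incl) (j ∘ mfil_incl M).
  by apply/mem_nfil; exists (idm _); rewrite compA ej compm1 comp1m.
by exists u; rewrite -compA Eu compA ej comp1m.
Qed.

Definition ev_morphism M : model_morphism nmodel M :=
  @ModelMorphism _ _ nmodel M (ev M) (ev_regular M) (eta_nat M) (ev_filter M).

(** * Uniqueness *)

Section Subquotient.
Variable c : nobj.

Lemma per_dom M : per M (Meet (Graph (idm _)) (rel c)).
Proof.
have [sy tr] := rel_per c M.
split=> [T x y /sat_Meet [/sat_id <- Rx] | T x y z /sat_Meet [/sat_id <- Rx]].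
  by apply/sat_Meet; split=> //; apply/sat_id.
by [].
Qed.

(** The elements that have a class, as a subobject of the constant object via [dom_in]; the cover
    [dom_out] sends them to their classes. Together they present [c] as a subquotient of a constant
    object. *)
Definition dom : ncat := NObj per_dom.

Lemma dom_in_tracked M T (x x' : hom T (mfun M (carr c))) :
  sat (rel dom) x x' ->
  sat (Graph (idm _)) (fmap (mfun M) (idm _) ∘ x) (fmap (mfun M) (idm _) ∘ x').
Proof. by move=> /sat_Meet [/sat_id <- _]; apply/sat_id. Qed.

Lemma dom_out_tracked M T (x x' : hom T (mfun M (carr c))) :
  sat (rel dom) x x' ->
  sat (rel c) (fmap (mfun M) (idm _) ∘ x) (fmap (mfun M) (idm _) ∘ x').
Proof. by rewrite fmap1 !comp1m => /sat_Meet []. Qed.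

Definition dom_in : hom dom (cfun (carr c)) :=
  sval (cid (@tracked dom (nconst (carr c)) _ dom_in_tracked)).

Definition dom_out : hom dom (c : ncat) :=
  sval (cid (@tracked dom c _ dom_out_tracked)).

Lemma nm_dom_in M T (x : hom T (mfun M (carr c))) (u : hom T (ev M dom)) :
  @nm M dom T x u -> eta M _ ∘ (fmap (ev M) dom_in ∘ u) = x.
Proof.
move=> n; have := svalP (cid (@tracked dom (nconst (carr c)) _ dom_in_tracked)) M _ _ _ n.
by move=> /nm_const ->; rewrite fmap1 comp1m.
Qed.

Lemma nm_dom_out M T (x : hom T (mfun M (carr c))) (u : hom T (ev M dom)) :
  @nm M dom T x u -> nm x (fmap (ev M) dom_out ∘ u).
Proof.
move=> n; have := svalP (cid (@tracked dom c _ dom_out_tracked)) M _ _ _ n.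
by rewrite fmap1 comp1m.
Qed.

Lemma nm_dom M T (u : hom T (ev M dom)) :
  nm (eta M _ ∘ (fmap (ev M) dom_in ∘ u)) (fmap (ev M) dom_out ∘ u).
Proof.
have [T' [q [rq [x n]]]] := nm_cover u; apply: (nm_local rq).
by rewrite -!compA (nm_dom_in n); apply: nm_dom_out.
Qed.

Lemma sat_dom M T (x : hom T (mfun M (carr c))) :
  sat (rel c) x x -> exists u, eta M _ ∘ (fmap (ev M) dom_in ∘ u) = x.
Proof.
move=> Rx; have /sat_nm [u [/nm_dom_in n _]] : sat (rel dom) x x.
  by apply/sat_Meet; split=> //; apply/sat_id.
by exists u.
Qed.

Lemma ev_dom_in_mono M : mono (fmap (ev M) dom_in).
Proof.
move=> T u v Euv; have [T' [q [rq [x [y [n n']]]]]] := nm_cover2 u v.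
apply: (regular_epi_epi rq); apply/(nm_eq n n')/sat_Meet.
have Exy : x = y.
  by rewrite -(nm_dom_in n) -(nm_dom_in n') !(compA _ _ q) Euv.
rewrite -Exy; have /sat_Meet := nm_sat n n; by [].
Qed.

Lemma dom_in_mono : mono dom_in.
Proof. by apply: ev_mono => M; apply: ev_dom_in_mono. Qed.

Lemma dom_out_cover : regular_epi dom_out.
Proof.
apply: ev_regular_epi_reflect => M; apply: cover_lift => // T z.
have [T' [q [rq [x n]]]] := nm_cover z; exists T', q; split=> //.
have [u Eu] := sat_dom (nm_sat n n); exists u.
by have := nm_dom u; rewrite Eu => n'; apply: nm_uniq n' n.
Qed.

End Subquotient.

(** Followed by [eta], both arrows send the element named x to x. This makes the final comparison
    compatible with the isomorphisms on constant objects. *)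
Lemma dom_in_out X : dom_in (cfun X) = dom_out (cfun X).
Proof.
apply: ev_faithful => M; apply: qob_arrow_ext => T x u n.
apply: (iso_mono (eta_iso M X)); rewrite (nm_dom_in n).
by have /nm_const -> := nm_dom_out n.
Qed.

(** The tabulating span lies in [ncat], so every morphism out of [nmodel] carries it along. In each
    model its legs take values in elements that have classes, so they factor through the [dom_in]
    monomorphisms. *)
Lemma arrow_tabulation (c d : ncat) (h : hom c d) (G : form (carr c) (carr d)) :
  (forall M, rep G (fmap (ev M) h)) ->
  exists U (p : hom U (dom c)) (q : hom U (dom d)),
    h ∘ (dom_out c ∘ p) = dom_out d ∘ q /\
    forall (M : model) (K : model_morphism nmodel M) T
        (x : hom T (mfun M (carr c))) (y : hom T (mfun M (carr d))),
      sat G x y <-> exists T' (r : hom T' T), regular_epi r /\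
        exists u : hom T' (mor K U),
          mor_iso K (carr c) ∘ (fmap (mor K) (dom_in c) ∘ (fmap (mor K) p ∘ u)) = x ∘ r /\
          mor_iso K (carr d) ∘ (fmap (mor K) (dom_in d) ∘ (fmap (mor K) q ∘ u)) = y ∘ r.
Proof.
move=> rG; have [U [p0 [q0 HU]]] := tabulation nmodel G.
(* The tabulation for [ev_morphism] is applied to the generic element, the identity of [ev M U]. *)
have gen M : exists z, nm (eta M _ ∘ fmap (ev M) p0) z /\
    nm (eta M _ ∘ fmap (ev M) q0) (fmap (ev M) h ∘ z).
  apply/rG/(HU M (ev_morphism M)); exists (ev M U), (idm _); split=> //.
  by exists (idm _).
have [M | M | p Ep] := @ev_lift_mono _ _ _ (dom_in c) p0.
- exact: ev_dom_in_mono.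
- have [z [n _]] := gen M; have [u Eu] := sat_dom (nm_sat n n).
  by exists u; apply: (iso_mono (eta_iso M _)).
have [M | M | q Eq] := @ev_lift_mono _ _ _ (dom_in d) q0.
- exact: ev_dom_in_mono.
- have [z [_ n]] := gen M; have [u Eu] := sat_dom (nm_sat n n).
  by exists u; apply: (iso_mono (eta_iso M _)).
exists U, p, q; split.
  apply: ev_faithful => M; have [z [n n']] := gen M.
  have := nm_dom (fmap (ev M) p); rewrite -fmapM Ep => /(nm_uniq n) Ez.
  have := nm_dom (fmap (ev M) q); rewrite -fmapM Eq => /(nm_uniq n') Ew.
  by rewrite !fmapM -Ez.
move=> M K T x y; apply: (iff_trans (HU M K T x y)).
by rewrite -Ep -Eq !fmapM; split=> [] [T' [r [rr [u [E1 E2]]]]];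
  exists T', r; split=> //; exists u; rewrite -E1 -E2 !compA.
Qed.

Lemma rep_id M (c : ncat) : rep (rel c) (fmap (ev M) (idm c)).
Proof.
move=> T x y; rewrite fmap1; split=> [/sat_nm [z [n n']] | [z [n]]].
  by exists z; rewrite comp1m.
by rewrite comp1m => n'; apply: nm_sat n n'.
Qed.
Arguments rep_id M c : clear implicits.

Section Uniqueness.
Variables (M : model) (K : model_morphism nmodel M).

(** Names for elements of [mor K c], read off the image under [mor K] of the presentation of [c] as
    a subquotient. *)
Definition knm (c : ncat) T (x : hom T (mfun M (carr c))) (z : hom T (mor K c)) :=
  exists u : hom T (mor K (dom c)),
    mor_iso K (carr c) ∘ (fmap (mor K) (dom_in c) ∘ u) = x /\
    fmap (mor K) (dom_out c) ∘ u = z.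

Lemma mor_dom_in_mono (c : ncat) :
  mono (mor_iso K (carr c) ∘ fmap (mor K) (dom_in c)).
Proof.
apply: mono_comp; first exact/iso_mono/cpt_iso.
by apply: fmap_mono; [case: (mor_regular K) | exact: dom_in_mono].
Qed.

Lemma mor_dom_in_inj (c : ncat) T (u v : hom T (mor K (dom c))) :
  mor_iso K (carr c) ∘ (fmap (mor K) (dom_in c) ∘ u) =
  mor_iso K (carr c) ∘ (fmap (mor K) (dom_in c) ∘ v) -> u = v.
Proof. by rewrite !compA => /mor_dom_in_mono. Qed.

(** In [ncat] the span tabulating [rel c] covers the kernel pair of [dom_out c]. Since [mor K]
    preserves both kernel pair and cover, two names have the same class in [mor K c] exactly when
    they satisfy [rel c] in [M]. *)
Lemma knm_quotient (c : ncat) : is_quotient (rel c) (knm (c := c)).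
Proof.
have [U [p [q [Epq HU]]]] := arrow_tabulation (fun M => rep_id M c).
rewrite comp1m in Epq.
have [L [l [r [pb pbM]]]] := ncat_pullback (dom_out c) (dom_out c).
have [k [[Ek1 Ek2] _]] := pb.2 _ _ _ Epq.
(* Checked at the evaluations, where the tabulation for [ev_morphism] supplies the lift. *)
have rk : regular_epi k.
  apply: ev_regular_epi_reflect => N; apply: cover_lift => // T y.
  have E1 : fmap (ev N) (dom_out c) ∘ (fmap (ev N) l ∘ y) =
            fmap (ev N) (dom_out c) ∘ (fmap (ev N) r ∘ y).
    by rewrite !compA (pbM N).1.
  have n := nm_dom (fmap (ev N) l ∘ y); have n' := nm_dom (fmap (ev N) r ∘ y).
  rewrite -E1 in n'.
  have /(HU N (ev_morphism N)) [T' [s [rs [u [F1 F2]]]]] := nm_sat n n'.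
  exists T', s; split=> //; exists u; apply: (pullback_ext (pbM N)).
    rewrite !compA -fmapM Ek1; apply: (@ev_dom_in_mono c N).
    by apply: (iso_mono (eta_iso N _)); rewrite !compA; rewrite /= !compA in F1.
  rewrite !compA -fmapM Ek2; apply: (@ev_dom_in_mono c N).
  by apply: (iso_mono (eta_iso N _)); rewrite !compA; rewrite /= !compA in F2.
have [[_ Kpb] Kre] := mor_regular K.
split.
- move=> T T' x z s [u [<- <-]]; exists (u ∘ s); by rewrite !compA.
- move=> T z.
  have [T' [s [u [rs Eu]]]] := cover_pull (model_regular M) z (Kre _ _ _ (dom_out_cover c)).
  exists T', s; split=> //.
  by exists (mor_iso K (carr c) ∘ (fmap (mor K) (dom_in c) ∘ u)), u.
- move=> T x x' z z' [v [Ex Ez]] [v' [Ex' Ez']]; split=> [|Ezz].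
    move=> /(HU M K) [T' [s [rs [u [F1 F2]]]]].
    apply: (regular_epi_epi rs).
    have G1 : fmap (mor K) p ∘ u = v ∘ s by apply: mor_dom_in_inj; rewrite F1 -Ex -!compA.
    have G2 : fmap (mor K) q ∘ u = v' ∘ s by apply: mor_dom_in_inj; rewrite F2 -Ex' -!compA.
    by rewrite -Ez -Ez' -!compA -G1 -G2 !compA -!fmapM Epq.
  have [|w [[Ev Ev'] _]] := (Kpb _ _ _ _ _ _ _ _ pb).2 _ v v'; first by rewrite Ez Ez'.
  have [T' [s [u [rs Eu]]]] := cover_pull (model_regular M) w (Kre _ _ _ rk).
  apply/(HU M K); exists T', s; split=> //; exists u.
  rewrite -Ek1 -Ek2 !fmapM -!(compA _ (fmap (mor K) k)) Eu.
  by rewrite -Ex -Ex' -Ev -Ev' !compA.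
- move=> T x /(HU M K) [T' [s [rs [u [F1 _]]]]].
  have [v Ev] : mem (mor_iso K (carr c) ∘ fmap (mor K) (dom_in c)) x.
    apply: (mem_cover (@mor_dom_in_mono c) rs).
    by exists (fmap (mor K) p ∘ u); rewrite -compA.
  by exists (fmap (mor K) (dom_out c) ∘ v), v; rewrite compA.
Qed.

(** The span tabulating [code h] commutes with [h] in [ncat]; applying [mor K] to that square sends
    a name of z to a name of its image, at first after a cover. *)
Lemma knm_arrow (c d : ncat) (h : hom c d) T (x : hom T (mfun M (carr c)))
    (y : hom T (mfun M (carr d))) z :
  sat (code h) x y -> knm x z -> knm y (fmap (mor K) h ∘ z).
Proof.
have [U [p [q [Epq HU]]]] := arrow_tabulation (fun M => rep_code M h).
move=> /(HU M K) [T' [s [rs [u [F1 F2]]]]] [v [Ex Ez]].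
apply: (name_local (knm_quotient d) rs).
have G1 : fmap (mor K) p ∘ u = v ∘ s by apply: mor_dom_in_inj; rewrite F1 -Ex -!compA.
exists (fmap (mor K) q ∘ u); split=> //.
by rewrite compA -fmapM -Epq !fmapM -!compA G1 -Ez !compA.
Qed.

Definition comparison (c : ncat) : hom (ev M c) (mor K c) :=
  sval (cid (quotient_comparison (nmP M c) (knm_quotient c))).

Lemma comparison_iso (c : ncat) : iso (comparison c).
Proof. by case: (svalP (cid (quotient_comparison (nmP M c) (knm_quotient c)))). Qed.

Lemma nm_comparison (c : ncat) T (x : hom T (mfun M (carr c))) z :
  nm x z -> knm x (comparison c ∘ z).
Proof.
by case: (svalP (cid (quotient_comparison (nmP M c) (knm_quotient c)))) => _; apply.
Qed.

Lemma comparison_natural (c d : ncat) (h : hom c d) :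
  comparison d ∘ fmap (ev M) h = fmap (mor K) h ∘ comparison c.
Proof.
apply: qob_arrow_ext => T x z n; rewrite -!compA.
have [T' [q [rq [y n']]]] := nm_cover (fmap (ev M) h ∘ z).
apply: (regular_epi_epi rq); rewrite -!compA.
have Gxy : sat (code h) (x ∘ q) y.
  by apply/(sat_code h (nm_stable q n) n'); rewrite compA.
apply: (name_uniq (knm_quotient d) (x := y)).
  by apply: nm_comparison; rewrite compA.
exact: knm_arrow Gxy (nm_comparison (nm_stable q n)).
Qed.

Definition comparison_nat : nat_iso (ev M) (mor K) :=
  @NatIso _ _ (ev M) (mor K) comparison comparison_natural comparison_iso.

Lemma comparison_eta X : mor_iso K X ∘ comparison (cfun X) = eta M X.
Proof.
apply: qob_arrow_ext => T x z n; have /nm_const -> := n.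
have [u [Ex Ez]] := nm_comparison n.
by rewrite -compA -Ez -dom_in_out.
Qed.

End Uniqueness.

End Syntactic.

Theorem theorem41 (E : category) (hE : topos E) (AA : opca_pair E) :
  exists N : exact_model AA, pseudoinitial N.
Proof.
have [limE _] := hE; exists (nmodel AA limE) => M.
exists (ev_morphism limE M) => K; exists (comparison_nat K) => X.
exact: comparison_eta.
Qed.
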